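(* Let $p\ge7$ be a prime with $p\equiv3\pmod4$ and let $k=\frac{p+1}{2}$. Then the reduction modulo $p$ of the polynomial $P[\mathscr{C}_k\theta_{\mathbb{Z}}](j)$ splits over $\mathbb{F}_p$ into linear factors.
   Context: $M_k$ is the $\mathbb{Q}$-vector space of modular forms of weight $k$ for $\mathrm{SL}_2(\mathbb{Z})$ with rational $q$-expansion, $q=e^{2\pi i\tau}$. $E_k=1-\frac{2k}{B_k}\sum_{n\ge1}\bigl(\sum_{d\mid n}d^{k-1}\bigr)q^n$ is the Eisenstein series, $\Delta=\frac{1}{1728}(E_4^3-E_6^2)=q\prod_{n\ge1}(1-q^n)^{24}$, and $j=E_4^3/\Delta$. Every even $k\ge4$ is written uniquely as $k=12n_k+4a_k+6b_k$ with $n_k\in\mathbb{Z}_{\ge0}$, $a_k\in\{0,1,2\}$, $b_k\in\{0,1\}$. For $f\in M_k$, $P[f]\in\mathbb{Q}[j]$ is the unique polynomial (of degree $\le n_k$) with $\frac{f(\tau)}{\Delta(\tau)^{n_k}E_4(\tau)^{a_k}E_6(\tau)^{b_k}}=P[f](j(\tau))$. For a power series $f(q)$ and even $k\ge4$, $\mathscr{C}_kf$ is the unique modular form of weight $k$ for $\mathrm{SL}_2(\mathbb{Z})$ with $\mathscr{C}_kf-f=\mathcal{O}(q^{n_k+1})$. The Jacobi theta series is $\theta_{\mathbb{Z}}=\sum_{n\in\mathbb{Z}}q^{n^2}$; $P[\mathscr{C}_k\theta_{\mathbb{Z}}]$ has integer coefficients, so it can be reduced modulo $p$. *)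

(* Defs.v *)
From HB Require Import structures.
From mathcomp Require Import all_boot all_order all_algebra.
From mathcomp Require Import all_classical all_reals all_analysis.
From mathcomp Require Export complex.

Set Implicit Arguments.
Unset Strict Implicit.
Unset Printing Implicit Defensive.

Import Order.TTheory GRing.Theory Num.Theory.
Import numFieldNormedType.Exports.

Local Open Scope classical_set_scope.
Local Open Scope ring_scope.
Local Open Scope complex_scope.

                                                                            
HB.instance Definition _ (R : realType) := NormedModule.copy R[i] R[i]^o.

Definition upper_half_plane (R : realType) : set R[i] :=
  [set tau | 0 < complex.Im tau].

Definition cexp (R : realType) (z : R[i]) : R[i] :=
  (expR (complex.Re z))%:C * (cos (complex.Im z) +i* sin (complex.Im z)).

Definition nome (R : realType) (tau : R[i]) : R[i] :=
  cexp (2 * (pi : R)%:C * 'i%C * tau).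

Definition qseries (R : realType) (a : nat -> R[i]) (tau : R[i]) :
    nat -> R[i] :=
  series (fun n => a n * nome tau ^+ n).

                                                                              
Definition has_qexpansion (R : realType) (f : R[i] -> R[i]) (a : nat -> R[i]) :=
  forall tau, upper_half_plane tau -> qseries a tau @ \oo --> f tau.

                                                                             
                                                                              
Definition modular_form (R : realType) (k : nat) (f : R[i] -> R[i]) :=
  [/\ forall tau, upper_half_plane tau -> derivable f tau 1,
      forall (a b c d : int) tau, a * d - b * c = 1 -> upper_half_plane tau ->
        f ((a%:~R * tau + b%:~R) / (c%:~R * tau + d%:~R)) =
        (c%:~R * tau + d%:~R) ^+ k * f tau
    & exists a, has_qexpansion f a].

                                             
                                                    
Fixpoint bernoulli_seq (m : nat) : seq rat :=
  if m is m'.+1 then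
    let s := bernoulli_seq m' in
    rcons s (- (\sum_(j < m) 'C(m.+1, j)%:R * s`_j) / m.+1%:R)
  else [:: 1].

Definition bernoulli (m : nat) : rat := (bernoulli_seq m)`_m.

Definition eisenstein_coef (k n : nat) : rat :=
  if n == 0%N then 1
  else - (2 * k%:R / bernoulli k) * (\sum_(d <- divisors n) d ^ k.-1)%N%:R.

Definition eisenstein (R : realType) (k : nat) (tau : R[i]) : R[i] :=
  lim (qseries (fun n => ratr (eisenstein_coef k n)) tau @ \oo).

Definition Delta (R : realType) (tau : R[i]) : R[i] :=
  (eisenstein 4 tau ^+ 3 - eisenstein 6 tau ^+ 2) / 1728.

Definition jinv (R : realType) (tau : R[i]) : R[i] :=
  eisenstein 4 tau ^+ 3 / Delta tau.

Definition weight_decomposition (k n a b : nat) : Prop :=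
  [/\ k = (12 * n + 4 * a + 6 * b)%N, (a < 3)%N & (b < 2)%N].

                                                      
Definition is_Ck (R : realType) (k n : nat) (g : nat -> R[i])
    (f : R[i] -> R[i]) :=
  modular_form k f /\
  exists2 c, has_qexpansion f c & forall m, (m <= n)%N -> c m = g m.

                                                                            
                                                                             
                                                                          
Definition is_Pf (R : realType) (n a b : nat) (f : R[i] -> R[i])
    (P : {poly rat}) :=
  (size P <= n.+1)%N /\
  forall tau, upper_half_plane tau ->
    let D := Delta tau ^+ n * eisenstein 4 tau ^+ a * eisenstein 6 tau ^+ b in
    D != 0 -> f tau / D = (map_poly ratr P).[jinv tau].

                                                                               
                                                                           
Definition theta_coef (m : nat) : nat :=
  #|[pred i : 'I_(m.*2.+1) | (i%:Z - m%:Z) ^+ 2 == m%:Z]|.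

Definition reduces_mod (p : nat) (P : {poly rat}) (r : {poly 'F_p}) :=
  exists2 Q : {poly int}, P = map_poly intr Q & r = map_poly intr Q.

Definition splits (F : fieldType) (r : {poly F}) : Prop :=
  exists s : seq F, r %= \prod_(x <- s) ('X - x%:P).

(* Main.v *)
(** Put [Q4 = x^2 + 14 x y + y^2], [Q6 = (x + y) (x^2 - 34 x y + y^2)] and
    [m = (p + 1) / 4]. At the fourth powers [x] and [y] of [theta_2 (2 tau)] and
    [theta_3 (2 tau)], the latter being the theta series [th] of the integers, these
    forms are [E4] and [E6].

    Modulo [p], the series [th ^ (p + 1) = th (q ^ p) * th (q)] agrees with [th] up to
    order [p], so the reduction of [C_k th], viewed as a form in the fourth roots of [x]
    and [y], agrees with [x ^ m + y ^ m] to order [n] in [q]. Both forms are invariant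
    under the octahedral group, hence their difference vanishes to order [4 (n + 1)] at
    each of the six vertices, which is more than its degree [p + 1] allows: they are
    equal. A root [z] of the reduced polynomial is the value of [j] at some [s] with
    [s ^ m = - 1], so [s ^ p = 1 / s], and [j (1 / s) = j (s)] yields [z ^ p = z].

    The coefficients of [P] are the solution of a unitriangular integral system, obtained
    by comparing expansions as [q] tends to [0] through positive reals; the same system
    modulo [p] determines the reduction.

    The identities [E4 = Q4] and [E6 = Q6] are only needed modulo [p] and to order [m].
    They follow there from Ramanujan's differential equations for [E2], [E4], [E6] and
    from the Kaneko-Zagier equation [16 th'' = 4 E2 th' - E2' th] with [' = q d/dq];
    all of these are identities between divisor sums with elementary proofs by
    Liouville's method. *)

Require Import Defs.
From HB Require Import structures.
From mathcomp Require Import all_boot all_order all_algebra.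
From mathcomp Require Import all_classical all_reals all_analysis.
From mathcomp Require Import closed_field finfield.
From mathcomp Require Import ring lra zify.

Set Implicit Arguments.
Unset Strict Implicit.
Unset Printing Implicit Defensive.

Import Order.TTheory GRing.Theory Num.Theory.

Local Open Scope ring_scope.

(** * Formal power series *)

(** A separate name for the sequences, so that they carry the Cauchy product and not a pointwise
    one. *)
Definition fps (R : Type) := nat -> R.

HB.instance Definition _ (R : Type) := gen_eqMixin (fps R).
HB.instance Definition _ (R : Type) := gen_choiceMixin (fps R).

Section FpsZmod.
Variable R : zmodType.
Implicit Types f g h : fps R.

Definition fps_add f g : fps R := fun n => f n + g n.
Definition fps_opp f : fps R := fun n => - f n.
Definition fps_zero : fps R := fun=> 0.

Lemma fps_addA : associative fps_add.
Proof. by move=> f g h; apply/funext => n; rewrite /fps_add addrA. Qed.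
Lemma fps_addC : commutative fps_add.
Proof. by move=> f g; apply/funext => n; rewrite /fps_add addrC. Qed.
Lemma fps_add0 : left_id fps_zero fps_add.
Proof. by move=> f; apply/funext => n; rewrite /fps_add add0r. Qed.
Lemma fps_addN : left_inverse fps_zero fps_opp fps_add.
Proof. by move=> f; apply/funext => n; rewrite /fps_add addNr. Qed.

HB.instance Definition _ :=
  GRing.isZmodule.Build (fps R) fps_addA fps_addC fps_add0 fps_addN.
End FpsZmod.

Section FpsRing.
Variable R : comNzRingType.
Implicit Types f g h : fps R.

Definition fps_trunc f n : {poly R} := \poly_(i < n.+1) f i.

(** Going through truncated polynomials lets associativity and commutativity be inherited from
    [{poly R}]: the coefficient at [n] of a product sees only coefficients up to [n]. *)
Definition fps_mul f g : fps R := fun n => (fps_trunc f n * fps_trunc g n)`_n.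
Definition fps_one : fps R := fun n => (n == 0)%:R.

Lemma fps_mulE f g n : fps_mul f g n = \sum_(i < n.+1) f i * g (n - i)%N.
Proof.
rewrite /fps_mul coefM; apply: eq_bigr => i _.
by rewrite !coef_poly ltn_ord ltnS leq_subr.
Qed.

Lemma coefM_eq (p p' q q' : {poly R}) n :
  (forall i, (i <= n)%N -> p`_i = p'`_i) -> (forall i, (i <= n)%N -> q`_i = q'`_i) ->
  (p * q)`_n = (p' * q')`_n.
Proof.
move=> hp hq; rewrite !coefM; apply: eq_bigr => i _.
by rewrite hp ?hq // ?leq_subr // -ltnS.
Qed.

Lemma coef_fps_trunc f n i : (i <= n)%N -> (fps_trunc f n)`_i = f i.
Proof. by move=> le_in; rewrite coef_poly ltnS le_in. Qed.

Lemma coef_fps_truncM f g n i : (i <= n)%N ->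
  (fps_trunc f n * fps_trunc g n)`_i = fps_mul f g i.
Proof.
move=> le_in; rewrite fps_mulE coefM; apply: eq_bigr => j _.
rewrite !coef_fps_trunc //; first exact: leq_trans (leq_subr _ _) le_in.
by rewrite (leq_trans _ le_in) // -ltnS.
Qed.

Lemma fps_mulA : associative fps_mul.
Proof.
move=> f g h; apply/funext => n; rewrite {1 3}/fps_mul.
have -> : (fps_trunc f n * fps_trunc (fps_mul g h) n)`_n =
    (fps_trunc f n * (fps_trunc g n * fps_trunc h n))`_n.
  by apply: coefM_eq => // i le_in; rewrite coef_fps_trunc // coef_fps_truncM.
rewrite mulrA; apply: coefM_eq => // i le_in.
by rewrite coef_fps_trunc // coef_fps_truncM.
Qed.
Lemma fps_mulC : commutative fps_mul.
Proof. by move=> f g; apply/funext => n; rewrite /fps_mul mulrC. Qed.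
Lemma fps_mul1 : left_id fps_one fps_mul.
Proof.
move=> f; apply/funext => n; rewrite fps_mulE big_ord_recl subn0 mul1r big1 ?addr0 //.
by move=> i _; rewrite mul0r.
Qed.
Lemma fps_mulDl : left_distributive fps_mul (@fps_add R).
Proof.
move=> f g h; apply/funext => n; rewrite /fps_add !fps_mulE -big_split.
by apply: eq_bigr => i _; rewrite mulrDl.
Qed.
Lemma fps_one_neq0 : fps_one != 0.
Proof. by apply/eqP => /(congr1 (fun f : fps R => f 0)) /eqP; rewrite oner_eq0. Qed.

HB.instance Definition _ := GRing.Zmodule_isComNzRing.Build (fps R)
  fps_mulA fps_mulC fps_mul1 fps_mulDl fps_one_neq0.

Lemma fpsD f g n : (f + g) n = f n + g n. Proof. by []. Qed.
Lemma fpsN f n : (- f) n = - f n. Proof. by []. Qed.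
Lemma fpsB f g n : (f - g) n = f n - g n. Proof. by []. Qed.
Lemma fps0 n : (0 : fps R) n = 0. Proof. by []. Qed.
Lemma fps1 n : (1 : fps R) n = (n == 0)%:R. Proof. by []. Qed.
Lemma fpsM f g n : (f * g) n = \sum_(i < n.+1) f i * g (n - i)%N.
Proof. exact: fps_mulE. Qed.
Lemma fpsMn f k n : (f *+ k) n = f n *+ k.
Proof. by elim: k => [|k IH]; rewrite ?mulr0n // !mulrS fpsD IH. Qed.
Lemma fps_nat k n : (k%:R : fps R) n = (k * (n == 0))%:R.
Proof. by rewrite fpsMn fps1 natrM mulr_natl. Qed.
Lemma fpsMnatl k f n : (k%:R * f) n = k%:R * f n.
Proof. by rewrite !mulr_natl fpsMn. Qed.
Lemma fps_sum I (r : seq I) (P : pred I) (F : I -> fps R) n :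
  (\sum_(i <- r | P i) F i) n = \sum_(i <- r | P i) F i n.
Proof. by elim/big_rec2: _ => // i y f _ <-. Qed.
Lemma fpsM0 f g : (f * g) 0 = f 0 * g 0.
Proof. by rewrite fpsM big_ord_recl big_ord0 addr0. Qed.
Lemma fpsX0 f k : (f ^+ k) 0 = f 0 ^+ k.
Proof. by elim: k => [|k IH]; rewrite ?fps1 // !exprS fpsM0 IH. Qed.

Lemma fpsM_low f g M n : (forall i, (i < M)%N -> f i = 0) -> (n < M)%N -> (f * g) n = 0.
Proof.
move=> hf hn; rewrite fpsM big1 // => i _.
by rewrite hf ?mul0r // (leq_ltn_trans _ hn) // -ltnS.
Qed.

Definition fpsC (c : R) : fps R := fun n => c *+ (n == 0).

Lemma fpsCM c f n : (fpsC c * f) n = c * f n.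
Proof.
rewrite fpsM big_ord_recl subn0 big1 ?addr0 // => i _.
by rewrite /fpsC mul0r.
Qed.

Lemma fpsC_additive : additive fpsC.
Proof. by move=> c d; apply/funext => n; rewrite fpsB /fpsC mulrnBl. Qed.
Lemma fpsC_multiplicative : multiplicative fpsC.
Proof.
split; last by [].
by move=> c d; apply/funext => n; rewrite fpsCM /fpsC mulrnAr.
Qed.
HB.instance Definition _ := GRing.isAdditive.Build R (fps R) fpsC fpsC_additive.
HB.instance Definition _ :=
  GRing.isMultiplicative.Build R (fps R) fpsC fpsC_multiplicative.

Definition fpsX : fps R := fun n => (n == 1)%:R.

Lemma fpsXM f n : (fpsX * f) n = if n is n'.+1 then f n' else 0.
Proof.
rewrite fpsM; case: n => [|n]; first by rewrite big_ord_recl big_ord0 mul0r addr0.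
rewrite 2!big_ord_recl big1 ?addr0 => [|i _]; last by rewrite /fpsX mul0r.
by rewrite mul0r add0r mul1r subSS subn0.
Qed.

Lemma fpsXnM k f n : (fpsX ^+ k * f) n = if (n < k)%N then 0 else f (n - k)%N.
Proof.
elim: k n => [|k IH] n; first by rewrite mul1r subn0.
by rewrite exprS -mulrA fpsXM; case: n => [|n] //; rewrite IH ltnS subSS.
Qed.

Lemma fps_shift f : f 0 = 0 -> f = fpsX * (fun n => f n.+1).
Proof. by move=> f0; apply/funext => -[|n]; rewrite fpsXM. Qed.

(* The derivation [q * d/dq]. *)
Definition fpsD1 f : fps R := fun n => f n *+ n.

Lemma fpsD1E f n : fpsD1 f n = n%:R * f n. Proof. by rewrite /fpsD1 mulr_natl. Qed.
Lemma fpsD1D f g : fpsD1 (f + g) = fpsD1 f + fpsD1 g.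
Proof. by apply/funext => n; rewrite /fpsD1 !fpsD mulrnDl. Qed.
Lemma fpsD1N f : fpsD1 (- f) = - fpsD1 f.
Proof. by apply/funext => n; rewrite /fpsD1 !fpsN mulNrn. Qed.
Lemma fpsD1B f g : fpsD1 (f - g) = fpsD1 f - fpsD1 g.
Proof. by rewrite fpsD1D fpsD1N. Qed.
Lemma fpsD1M f g : fpsD1 (f * g) = fpsD1 f * g + f * fpsD1 g.
Proof.
apply/funext => n; rewrite fpsD1E fpsD !fpsM mulr_sumr -big_split; apply: eq_bigr => i _.
have le_in : (i <= n)%N by rewrite -ltnS.
rewrite !fpsD1E -{1}(subnKC le_in) natrD mulrDl; congr (_ + _).
  by rewrite mulrA.
by rewrite mulrCA.
Qed.
Lemma fpsD1C c : fpsD1 (fpsC c) = 0.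
Proof. by apply/funext => -[|n]; rewrite /fpsD1 /fpsC ?mulr0n // mul0rn. Qed.
Lemma fpsD1_nat k : fpsD1 k%:R = 0.
Proof. by rewrite -(rmorph_nat fpsC) fpsD1C. Qed.
Lemma fpsD1X f k : fpsD1 (f ^+ k.+1) = k.+1%:R * f ^+ k * fpsD1 f.
Proof.
elim: k => [|k IH]; first by rewrite mulr1 mul1r.
rewrite exprS fpsD1M IH [k.+2%:R]mulrS exprS.
by move: (fpsD1 f) (f ^+ k) (k.+1%:R : fps R) => u v w; ring.
Qed.

End FpsRing.

Section FpsMap.
Variables (R S : comNzRingType) (phi : {rmorphism R -> S}).
Definition map_fps (f : fps R) : fps S := fun n => phi (f n).
Lemma map_fps_additive : additive map_fps.
Proof. by move=> f g; apply/funext => n; rewrite fpsB /map_fps fpsB rmorphB. Qed.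
Lemma map_fps_multiplicative : multiplicative map_fps.
Proof.
split=> [f g|]; apply/funext => n; last by rewrite /map_fps !fps1 rmorph_nat.
by rewrite /map_fps !fpsM rmorph_sum; apply: eq_bigr => i _; rewrite rmorphM.
Qed.
HB.instance Definition _ := GRing.isAdditive.Build _ _ map_fps map_fps_additive.
HB.instance Definition _ :=
  GRing.isMultiplicative.Build _ _ map_fps map_fps_multiplicative.
Lemma map_fpsD1 f : map_fps (fpsD1 f) = fpsD1 (map_fps f).
Proof. by apply/funext => n; rewrite /map_fps /fpsD1 rmorphMn. Qed.
End FpsMap.

(** * Convolutions of divisor sums *)

Lemma big_involution (T : eqType) (V : nmodType) (s : seq T) (P Q : pred T)
    (tau : T -> T) (F : T -> V) : uniq s ->
    (forall x, x \in s -> P x -> [/\ tau x \in s, Q (tau x) & tau (tau x) = x]) ->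
    (forall x, x \in s -> Q x -> [/\ tau x \in s, P (tau x) & tau (tau x) = x]) ->
  \sum_(x <- s | Q x) F x = \sum_(x <- s | P x) F (tau x).
Proof.
move=> us hP hQ; rewrite -big_filter -[RHS]big_filter -(big_map tau xpredT).
apply: perm_big; apply: uniq_perm; first exact: filter_uniq.
  rewrite map_inj_in_uniq ?filter_uniq // => x y.
  rewrite !mem_filter => /andP[Px xs] /andP[Py ys] e.
  by have [_ _ <-] := hP x xs Px; have [_ _ <-] := hP y ys Py; rewrite e.
move=> x; rewrite mem_filter; apply/andP/mapP => [[Qx xs]|[y]].
  have [txs Ptx ttx] := hQ x xs Qx.
  by exists (tau x); rewrite ?mem_filter ?Ptx.
by rewrite mem_filter => /andP[Py ys] ->; have [-> ->] := hP y ys Py.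
Qed.

Lemma big_anti_involution (T : eqType) (s : seq T) (P : pred T)
    (tau : T -> T) (F : T -> int) : uniq s ->
    (forall x, x \in s -> P x ->
      [/\ tau x \in s, P (tau x), tau (tau x) = x & F (tau x) = - F x]) ->
  \sum_(x <- s | P x) F x = 0.
Proof.
move=> us h.
suff e : \sum_(x <- s | P x) F x = - \sum_(x <- s | P x) F x by lia.
rewrite {1}(@big_involution _ _ s P P tau) => [||x xs /(h x xs)[]|x xs /(h x xs)[]] //.
rewrite -sumrN big_seq_cond [RHS]big_seq_cond; apply: eq_bigr => x /andP[xs Px].
by have [] := h x xs Px.
Qed.

(* [divisors 0] is [[:: 1]], whence the case distinction. *)
Definition factorizations (m : nat) : seq (nat * nat) :=
  if m is 0 then [::] else [seq (d, m %/ d)%N | d <- divisors m].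

Lemma mem_factorizations m d e :
  ((d, e) \in factorizations m) = [&& (0 < d)%N, (0 < e)%N & (d * e == m)%N].
Proof.
case: m => [|m]; first by apply/esym/and3P => -[d0 e0]; rewrite muln_eq0; lia.
apply/mapP/and3P => [[d' hd' [-> ->]]|[d0 e0 /eqP ede]].
  move: hd'; rewrite -dvdn_divisors // => hd'.
  have d0 : (0 < d')%N by exact: dvdn_gt0 hd'.
  split; [exact: d0 | by rewrite divn_gt0 // dvdn_leq | by rewrite mulnC divnK].
exists d; last by rewrite -ede mulKn.
by rewrite -dvdn_divisors // -ede dvdn_mulr.
Qed.

Lemma factorizations_uniq m : uniq (factorizations m).
Proof. by case: m => // m; rewrite map_inj_uniq ?divisors_uniq // => d e []. Qed.

Definition sigma (r : nat) : fps int :=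
  fun n => \sum_(u <- factorizations n) u.1%:Z ^+ r.

Lemma sigma0 r : sigma r 0%N = 0.
Proof. by rewrite /sigma big_nil. Qed.

Lemma sigmaE r n : (0 < n)%N -> sigma r n = (\sum_(d <- divisors n) d ^ r)%N%:Z.
Proof.
case: n => // n _; rewrite /sigma big_map /= -[in RHS]natz natr_sum; apply: eq_bigr => d _.
by rewrite natrX natz.
Qed.

(* A quadruple [((a, x), (b, y))] stands for a solution of [a * x + b * y = n]. *)
Definition quads (n : nat) : seq ((nat * nat) * (nat * nat)) :=
  flatten [seq [seq (u, v) | u <- factorizations m, v <- factorizations (n - m)]
          | m <- iota 0 n.+1].

Lemma mem_quads n a x b y : (((a, x), (b, y)) \in quads n) =
  [&& (0 < a)%N, (0 < x)%N, (0 < b)%N, (0 < y)%N & (a * x + b * y == n)%N].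
Proof.
apply/flatten_mapP/and5P => [[m]|[a0 x0 b0 y0 /eqP e]].
  rewrite mem_iota add0n ltnS /= => le_mn /allpairsP[[u v] /= [+ + [hu hv]]].
  rewrite -hu -hv !mem_factorizations => /and3P[-> -> /eqP ea] /and3P[-> -> /eqP eb].
  by split; rewrite // ea eb subnKC.
exists (a * x)%N; first by rewrite mem_iota; lia.
apply/allpairsP; exists ((a, x), (b, y)).
by rewrite !mem_factorizations a0 x0 b0 y0 eqxx /=; split=> //; apply/eqP; lia.
Qed.

Lemma quads_uniq n : uniq (quads n).
Proof.
rewrite /quads; elim: (iota 0 n.+1) (iota_uniq 0 n.+1) => //= m s IH /andP[ms us].
rewrite cat_uniq IH // andbT allpairs_uniq ?factorizations_uniq //=; last first.
  by move=> [? ?] [? ?] _ _.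
apply/hasPn => -[[a x] [b y]] /flatten_mapP[m' m's].
move=> /allpairsP[[u v] /= [hu _ [eu ev]]]; apply/negP.
move=> /allpairsP[[u' v'] /= [hu' _ [eu' ev']]].
move: hu hu'; rewrite -eu -eu' !mem_factorizations => /and3P[_ _ /eqP E1] /and3P[_ _ /eqP E2].
by move: m's; rewrite -E1 E2 (negPf ms).
Qed.

Lemma sum_quads (V : nmodType) (F : nat * nat -> nat * nat -> V) n :
  \sum_(q <- quads n) F q.1 q.2 = \sum_(m < n.+1)
    \sum_(u <- factorizations m) \sum_(v <- factorizations (n - m)) F u v.
Proof.
rewrite big_flatten big_map -[RHS](big_mkord xpredT (fun m =>
  \sum_(u <- factorizations m) \sum_(v <- factorizations (n - m)) F u v)).
by rewrite /index_iota subn0; apply: eq_bigr => m _; rewrite big_allpairs.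
Qed.

Lemma sigmaM r s n :
  (sigma r * sigma s) n = \sum_(q <- quads n) q.1.1%:Z ^+ r * q.2.1%:Z ^+ s.
Proof.
rewrite (sum_quads (fun u v => u.1%:Z ^+ r * v.1%:Z ^+ s)) fpsM; apply: eq_bigr => m _.
rewrite /sigma mulr_suml; apply: eq_bigr => u _.
by rewrite mulr_sumr.
Qed.

Section Hexagonal.
Variable phi : int -> int -> int.
Hypothesis phiC : forall u v, phi u v = phi v u.
Hypothesis phi_rot : forall u v, phi v (v - u) = phi u v.

(** The rotation [(u, v) -> (v, v - u)] has order six and its cube is [- 1]. *)
Lemma phiN u v : phi (- u) (- v) = phi u v.
Proof.
by rewrite -[RHS]phi_rot -[RHS]phi_rot -[RHS]phi_rot; congr phi; ring.
Qed.

Lemma sum_quads_swap (F : nat -> nat -> nat -> nat -> int) n :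
  \sum_(q <- quads n) F q.1.1 q.1.2 q.2.1 q.2.2 =
  \sum_(q <- quads n) F q.1.2 q.1.1 q.2.2 q.2.1.
Proof.
rewrite (@big_involution _ _ _ xpredT xpredT
  (fun q => ((q.1.2, q.1.1), (q.2.2, q.2.1)))) ?quads_uniq //;
  move=> [[a x] [b y]]; rewrite !mem_quads /= => /and5P[-> -> -> -> e] _;
  by split=> //; rewrite mulnC [(y * b)%N]mulnC.
Qed.

(* The involution [(a, x, b, y) -> (x + y, b, x, a - b)] of the solutions with [a > b]
   negates [phi a b - phi x (- y)]; exchanging [(a, x)] and [(b, y)] settles [a < b]. *)
Lemma sum_quads_hexagonal n :
  \sum_(q <- quads n) (phi q.1.1 q.2.1 - phi q.1.1 (- q.2.1%:Z)) =
  \sum_(u <- factorizations n)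
    (u.2.-1%:Z * phi u.1 u.1 - \sum_(0 <= x < u.2.-1) phi u.2 x.+1).
Proof.
pose G (q : (nat * nat) * (nat * nat)) := phi q.1.1 q.2.1 - phi q.1.2 (- q.2.2%:Z).
(* Exchanging divisors with cofactors moves the second terms to [x] and [y]; in this form the
   involution negates the summand. *)
have -> : \sum_(q <- quads n) (phi q.1.1 q.2.1 - phi q.1.1 (- q.2.1%:Z)) =
    \sum_(q <- quads n) G q.
  rewrite !sumrB; congr (_ - _).
  by rewrite (sum_quads_swap (fun a x b y => phi a (- b%:Z))).
have gt0 : \sum_(q <- quads n | (q.2.1 < q.1.1)%N) G q = 0.
  apply: (@big_anti_involution _ _ _
    (fun q => ((q.1.2 + q.2.2, q.2.1), (q.1.2, q.1.1 - q.2.1)))%N); first exact: quads_uniq.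
  move=> [[a x] [b y]]; rewrite !mem_quads /= => /and5P[a0 x0 b0 y0 /eqP e] lt_ba.
  split; [|lia| |].
  - rewrite b0 x0 addn_gt0 x0 subn_gt0 lt_ba /=; apply/eqP; nia.
  - by congr (_, _, (_, _)); lia.
  - have := phi_rot (x + y)%N x; have := phi_rot a b; rewrite /G /= => <- <-.
    by rewrite opprB; congr (phi _ _ - phi _ _); lia.
have lt0 : \sum_(q <- quads n | (q.1.1 < q.2.1)%N) G q = 0.
  rewrite (@big_involution _ _ _ (fun q => q.2.1 < q.1.1)%N _
    (fun q => (q.2, q.1))) ?quads_uniq //.
  - rewrite -[RHS]gt0; apply: eq_bigr => -[[a x] [b y]] _.
    by rewrite /G /= (phiC b) (phiC y) -(phiN _ y) opprK.
  - move=> [[a x] [b y]]; rewrite !mem_quads /= => /and5P[-> -> -> -> e] h.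
    by rewrite addnC e.
  - move=> [[a x] [b y]]; rewrite !mem_quads /= => /and5P[-> -> -> -> e] h.
    by rewrite addnC e.
rewrite (bigID (fun q : (nat * nat) * (nat * nat) => q.2.1 < q.1.1)%N) /= gt0 add0r.
rewrite (bigID (fun q : (nat * nat) * (nat * nat) => q.1.1 < q.2.1)%N) /=.
rewrite [X in X + _](_ : _ = 0) ?add0r; last first.
  by rewrite -[RHS]lt0; apply: eq_bigl => -[[a x] [b y]] /=; lia.
(* The remaining solutions have [a = b], hence [a (x + y) = n]; they are indexed by the
   factorization [(a, x + y)] and by [x.-1]. *)
rewrite -big_filter.
rewrite (perm_big (flatten [seq [seq ((u.1, x.+1), (u.1, u.2 - x.+1)%N) |
   x <- index_iota 0 u.2.-1] | u <- factorizations n])).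
  rewrite big_flatten big_map /=; apply: eq_big_seq => -[d m] /= hu.
  rewrite big_map /G /= sumrB; congr (_ - _).
    by rewrite sumr_const_nat subn0 -mulr_natl natz.
  rewrite !big_seq; apply: eq_bigr => x; rewrite mem_index_iota => hx.
  by rewrite -[RHS]phi_rot; congr phi; lia.
apply: uniq_perm; first by rewrite filter_uniq ?quads_uniq.
  elim: (factorizations n) (factorizations_uniq n) => //= -[d m] s IH /andP[ms us].
  rewrite cat_uniq IH // andbT map_inj_uniq ?iota_uniq; last by move=> x y [].
  apply/hasPn => -[[a x] [b y]] /flatten_mapP[[d' m'] m's /mapP[z hz [-> -> _ e]]].
  apply/negP => /mapP[z' hz' [ed ez e']].
  move: hz hz'; rewrite !mem_index_iota /= => hz hz'.
  move=> e2; have em : m' = m by lia.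
  by move: m's; rewrite ed em (negPf ms).
move=> [[a x] [b y]]; rewrite mem_filter mem_quads /=.
apply/idP/flatten_mapP.
  move=> /andP[ab /and5P[a0 x0 b0 y0 /eqP e]].
  have eab : a = b by lia.
  exists (a, x + y)%N; first by rewrite mem_factorizations a0 addn_gt0 x0 -e eab mulnDr /=.
  apply/mapP; exists x.-1; first by rewrite mem_index_iota /=; lia.
  by rewrite /= prednK // addKn eab.
move=> [[d m]]; rewrite mem_factorizations => /and3P[d0 m0 /eqP <-] /mapP[z].
rewrite mem_index_iota => /= hz [-> -> -> ->].
rewrite ltnn d0 /=; apply/andP; split; first lia.
by rewrite -mulnDr; apply/eqP; congr (_ * _)%N; lia.
Qed.
End Hexagonal.

Lemma sum_factorizationsC (V : nmodType) (F : nat -> nat -> V) n :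
  \sum_(u <- factorizations n) F u.1 u.2 = \sum_(u <- factorizations n) F u.2 u.1.
Proof.
rewrite (@big_involution _ _ _ xpredT xpredT (fun u => (u.2, u.1)))
  ?factorizations_uniq //; move=> [d m]; rewrite !mem_factorizations /= => /and3P[-> -> e] _;
  by rewrite mulnC.
Qed.

(** The set of factorizations is stable under [(d, m) -> (m, d)], so only the symmetrized summands
    matter. Writing the factors as successors keeps truncated predecessors out of the condition. *)
Lemma eq_sum_factorizations (E F : nat -> nat -> int) n :
    (forall d m, n = (d.+1 * m.+1)%N ->
      E d.+1 m.+1 + E m.+1 d.+1 = F d.+1 m.+1 + F m.+1 d.+1) ->
  \sum_(u <- factorizations n) E u.1 u.2 = \sum_(u <- factorizations n) F u.1 u.2.
Proof.
move=> h.
suff : \sum_(u <- factorizations n) E u.1 u.2 + \sum_(u <- factorizations n) E u.1 u.2 =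
  \sum_(u <- factorizations n) F u.1 u.2 + \sum_(u <- factorizations n) F u.1 u.2 by lia.
rewrite [X in _ + X]sum_factorizationsC [X in _ = _ + X]sum_factorizationsC -!big_split.
rewrite big_seq [RHS]big_seq; apply: eq_bigr => -[d m].
by rewrite mem_factorizations => /and3P[]; case: d => // d; case: m => // m _ _ /eqP/esym/h.
Qed.

(** Reduces a convolution identity to polynomial identities within reach of [ring]. [W] is twice the
    part of [phi] odd in [v], and [T M k] is [c] times the sum of [phi M x] for [1 <= x <= k], where
    [c] clears the denominators of the power sum formulas. *)
Lemma hexagonal_convolution (phi T W F : int -> int -> int) (c : int) n :
    (forall u v, phi u v = phi v u) -> (forall u v, phi v (v - u) = phi u v) ->
    (forall u v, phi u v - phi u (- v) = W u v) ->
    (forall M, T M 0 = 0) -> (forall M k, T M (k + 1) = T M k + c * phi M (k + 1)) ->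
    (forall d m, c * (m * phi (d + 1) (d + 1)) - T (m + 1) m +
                 (c * (d * phi (m + 1) (m + 1)) - T (d + 1) d) =
                 F (d + 1) (m + 1) + F (m + 1) (d + 1)) ->
  c * (\sum_(q <- quads n) W q.1.1 q.2.1) = \sum_(u <- factorizations n) F u.1 u.2.
Proof.
move=> phiC phiR hW T0 TS hF.
have hT (M : int) k : c * (\sum_(0 <= x < k) phi M x.+1) = T M k.
  elim: k => [|k IH]; first by rewrite big_nil mulr0 T0.
  by rewrite big_nat_recr //= mulrDr IH -addn1 PoszD TS.
under eq_bigr do rewrite -hW.
rewrite sum_quads_hexagonal // mulr_sumr.
apply: (eq_sum_factorizations (E := fun d m => c * (m.-1%:Z * phi d d -
  \sum_(0 <= x < m.-1) phi m x.+1)) (F := fun d m => F d m)) => d m _ /=.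
by rewrite !mulrBr !hT -(addn1 d) -(addn1 m) !PoszD hF.
Qed.

(** Here [phi] is the norm form [N = u^2 - u v + v^2] of the hexagonal lattice. *)
Lemma sigmaM11 n : 12 * (sigma 1 * sigma 1) n =
  5 * sigma 3 n + sigma 1 n - 6 * n%:Z * sigma 1 n.
Proof.
have := @hexagonal_convolution (fun u v => u ^+ 2 - u * v + v ^+ 2)
  (fun M k => 6 * M ^+ 2 * k - 3 * M * k * (k + 1) + k * (k + 1) * (2 * k + 1))
  (fun u v => - 2 * (u * v)) (fun d m => - (5 * d ^+ 3 + d - 6 * (d * m) * d)) 6 n.
move=> /(_ _ _ _ _ _ _)/wrap[]; try by move=> *; ring.
rewrite -mulr_sumr => h.
have -> : (sigma 1 * sigma 1) n = \sum_(q <- quads n) q.1.1%:Z * q.2.1%:Z by exact: sigmaM.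
suff -> : 5 * sigma 3 n + sigma 1 n - 6 * n%:Z * sigma 1 n =
  - \sum_(u <- factorizations n) - (5 * u.1%:Z ^+ 3 + u.1%:Z - 6 * (u.1%:Z * u.2%:Z) * u.1%:Z).
  by rewrite -h; ring.
rewrite /sigma !mulr_sumr -!sumrN -!big_split /=; apply: eq_big_seq => -[d m].
by rewrite mem_factorizations => /and3P[_ _ /eqP <-] /=; rewrite PoszM; ring.
Qed.

(** Here [phi = N^2] with [N = u^2 - u v + v^2]. Its odd part contains [u^3 v] and [u v^3], which
    contribute the same convolution. *)
Lemma sigmaM13 n : 240 * (sigma 1 * sigma 3) n =
  21 * sigma 5 n + 10 * sigma 3 n - 30 * n%:Z * sigma 3 n - sigma 1 n.
Proof.
have := @hexagonal_convolution
  (fun u v => u ^+ 4 - 2 * u ^+ 3 * v + 3 * u ^+ 2 * v ^+ 2 - 2 * u * v ^+ 3 + v ^+ 4)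
  (fun M k => 30 * M ^+ 4 * k - 30 * M ^+ 3 * k * (k + 1)
    + 15 * M ^+ 2 * k * (k + 1) * (2 * k + 1) - 15 * M * k ^+ 2 * (k + 1) ^+ 2
    + k * (k + 1) * (2 * k + 1) * (3 * k ^+ 2 + 3 * k - 1))
  (fun u v => - 4 * (u ^+ 3 * v) + - 4 * (u * v ^+ 3))
  (fun d m => - (21 * d ^+ 5 + 10 * d ^+ 3 - 30 * (d * m) * d ^+ 3 - d)) 30 n.
move=> /(_ _ _ _ _ _ _)/wrap[]; try by move=> *; ring.
rewrite big_split /= -!mulr_sumr => h.
have e1 : (sigma 1 * sigma 3) n = \sum_(q <- quads n) q.1.1%:Z * q.2.1%:Z ^+ 3 by exact: sigmaM.
have e3 : (sigma 1 * sigma 3) n = \sum_(q <- quads n) q.1.1%:Z ^+ 3 * q.2.1%:Z.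
  by rewrite mulrC; exact: sigmaM.
rewrite -e1 -e3 in h.
suff -> : 21 * sigma 5 n + 10 * sigma 3 n - 30 * n%:Z * sigma 3 n - sigma 1 n =
  - \sum_(u <- factorizations n) - (21 * u.1%:Z ^+ 5 + 10 * u.1%:Z ^+ 3
    - 30 * (u.1%:Z * u.2%:Z) * u.1%:Z ^+ 3 - u.1%:Z).
  by rewrite -h; ring.
rewrite /sigma !mulr_sumr -!sumrN -!big_split /=; apply: eq_big_seq => -[d m].
by rewrite mem_factorizations => /and3P[_ _ /eqP <-] /=; rewrite PoszM; ring.
Qed.

(** In degree six the invariants are spanned by [N^3] and [D = (u v (u - v))^2], where
    [N = u^2 - u v + v^2]; [phi = 2 N^3 - 7 D] is chosen to have no term [u^3 v^3]. *)
Lemma sigmaM15 n : 504 * (sigma 1 * sigma 5) n =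
  20 * sigma 7 n + 21 * sigma 5 n - 42 * n%:Z * sigma 5 n + sigma 1 n.
Proof.
have := @hexagonal_convolution
  (fun u v => 2 * u ^+ 6 - 6 * u ^+ 5 * v + 5 * u ^+ 4 * v ^+ 2 + 5 * u ^+ 2 * v ^+ 4
    - 6 * u * v ^+ 5 + 2 * v ^+ 6)
  (fun M k => 84 * M ^+ 6 * k - 126 * M ^+ 5 * k * (k + 1)
    + 35 * M ^+ 4 * k * (k + 1) * (2 * k + 1)
    + 7 * M ^+ 2 * k * (k + 1) * (2 * k + 1) * (3 * k ^+ 2 + 3 * k - 1)
    - 21 * M * k ^+ 2 * (k + 1) ^+ 2 * (2 * k ^+ 2 + 2 * k - 1)
    + 2 * k * (k + 1) * (2 * k + 1) * (3 * k ^+ 4 + 6 * k ^+ 3 - 3 * k + 1))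
  (fun u v => - 12 * (u ^+ 5 * v) + - 12 * (u * v ^+ 5))
  (fun d m => - 2 * (20 * d ^+ 7 + 21 * d ^+ 5 - 42 * (d * m) * d ^+ 5 + d)) 42 n.
move=> /(_ _ _ _ _ _ _)/wrap[]; try by move=> *; ring.
rewrite big_split /= -!mulr_sumr => h.
have e1 : (sigma 1 * sigma 5) n = \sum_(q <- quads n) q.1.1%:Z * q.2.1%:Z ^+ 5 by exact: sigmaM.
have e3 : (sigma 1 * sigma 5) n = \sum_(q <- quads n) q.1.1%:Z ^+ 5 * q.2.1%:Z.
  by rewrite mulrC; exact: sigmaM.
rewrite -e1 -e3 in h.
suff -> : 20 * sigma 7 n + 21 * sigma 5 n - 42 * n%:Z * sigma 5 n + sigma 1 n =
  \sum_(u <- factorizations n) (20 * u.1%:Z ^+ 7 + 21 * u.1%:Z ^+ 5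
    - 42 * (u.1%:Z * u.2%:Z) * u.1%:Z ^+ 5 + u.1%:Z) by lia.
rewrite /sigma !mulr_sumr -!sumrN -!big_split /=; apply: eq_big_seq => -[d m].
by rewrite mem_factorizations => /and3P[_ _ /eqP <-] /=; rewrite PoszM; ring.
Qed.

(** Here [phi = (u v (u - v))^2], whose only term odd in [v] is [- 2 u^3 v^3]. *)
Lemma sigmaM33 n : 120 * (sigma 3 * sigma 3) n = sigma 7 n - sigma 3 n.
Proof.
have := @hexagonal_convolution
  (fun u v => u ^+ 4 * v ^+ 2 - 2 * u ^+ 3 * v ^+ 3 + u ^+ 2 * v ^+ 4)
  (fun M k => 5 * M ^+ 4 * k * (k + 1) * (2 * k + 1) - 15 * M ^+ 3 * k ^+ 2 * (k + 1) ^+ 2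
    + M ^+ 2 * k * (k + 1) * (2 * k + 1) * (3 * k ^+ 2 + 3 * k - 1))
  (fun u v => - 4 * (u ^+ 3 * v ^+ 3))
  (fun d m => - (d ^+ 7 - d ^+ 3)) 30 n.
move=> /(_ _ _ _ _ _ _)/wrap[]; try by move=> *; ring.
rewrite -!mulr_sumr => h.
rewrite sigmaM.
suff -> : sigma 7 n - sigma 3 n = - \sum_(u <- factorizations n) - (u.1%:Z ^+ 7 - u.1%:Z ^+ 3).
  by rewrite -h; ring.
by rewrite /sigma -!sumrN -!big_split /=; apply: eq_bigr => u _; ring.
Qed.

(** * The theta series and divisor sums *)

Definition ints (n : nat) : seq int := [seq i%:Z - n%:Z | i <- iota 0 n.*2.+1].

Lemma mem_ints n (i : int) : (i \in ints n) = (`|i| <= n)%N.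
Proof.
apply/mapP/idP => [[j]|h]; first by rewrite mem_iota => hj ->; lia.
by exists (absz (i + n%:Z)); [rewrite mem_iota; lia | lia].
Qed.

Lemma ints_uniq n : uniq (ints n).
Proof. by rewrite map_inj_uniq ?iota_uniq // => i j; lia. Qed.

Definition theta : fps int := fun n => (theta_coef n)%:Z.

Lemma theta_sum (M n : nat) : (n <= M)%N ->
  theta n = \sum_(i <- ints M | (`|i| ^ 2 == n)%N) 1.
Proof.
move=> le_nM.
transitivity (\sum_(i <- ints n | (`|i| ^ 2 == n)%N) 1 : int).
  rewrite /theta /theta_coef -sum1_card -natz natr_sum big_map.
  rewrite -[iota _ _]/(index_iota 0 n.*2.+1) big_mkord.
  by apply: eq_bigl => i; rewrite !inE; apply/eqP/eqP; lia.
rewrite -big_filter -[RHS]big_filter; apply: perm_big.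
apply: uniq_perm; rewrite ?filter_uniq ?ints_uniq // => i.
by rewrite !mem_filter !mem_ints; case: eqP => //= e; apply/idP/idP; nia.
Qed.

Lemma theta_nsquare n : (~ exists s, s ^ 2 = n)%N -> theta n = 0.
Proof.
move=> nsq; rewrite (theta_sum (leqnn n)) big_pred0 // => i.
by apply/eqP => e; apply: nsq; exists `|i|%N.
Qed.

Lemma theta_square s : (0 < s)%N -> theta (s ^ 2)%N = 2.
Proof.
move=> s_gt0; rewrite (theta_sum (leqnn _)) -big_filter.
rewrite (perm_big [:: s%:Z; - s%:Z]) ?big_cons ?big_nil //.
apply: uniq_perm; first by rewrite filter_uniq ?ints_uniq.
  by rewrite /= mem_seq1 andbT; lia.
move=> i; rewrite mem_filter mem_ints !inE; apply/andP/orP; first by move=> [/eqP]; nia.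
move=> h; have -> : `|i|%N = s by case: h => /eqP ->; lia.
by split; [exact: eqxx | nia].
Qed.

(** The solutions of [i^2 + d e = n]. When [i^2 >= n] the truncated difference is [0], which has no
    factorizations. *)
Definition triples (n : nat) : seq (int * (nat * nat)) :=
  [seq (i, u) | i <- ints n, u <- factorizations (n - `|i| ^ 2)].

Lemma absz_sqr (i : int) : (`|i| ^ 2)%N%:Z = i ^+ 2.
Proof. by rewrite -mulnn PoszM abszE -expr2 real_normK ?num_real. Qed.

Lemma mem_triples n i d e : ((i, (d, e)) \in triples n) =
  [&& (0 < d)%N, (0 < e)%N & i ^+ 2 + d%:Z * e%:Z == n%:Z].
Proof.
rewrite -absz_sqr; apply/allpairsPdep/and3P => [[j [[d' e'] [hj hu [-> -> ->]]]]|[d0 e0 /eqP E]].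
  move: hu; rewrite mem_factorizations => /and3P[d0 e0 /eqP E].
  have de0 : (0 < d' * e')%N by rewrite muln_gt0 d0.
  by split=> //; apply/eqP; move: E de0; rewrite -PoszM; set z := (_ * _)%N; set w := (_ ^ _)%N; lia.
exists i, (d, e); rewrite mem_ints mem_factorizations d0 e0 /=.
move: E; rewrite -PoszM => E; split=> //; first by nia.
by apply/eqP; move: E; set z := (_ * _)%N; set w := (_ ^ _)%N; lia.
Qed.

Lemma triples_uniq n : uniq (triples n).
Proof.
apply: allpairs_uniq_dep; first exact: ints_uniq.
  by move=> i _; exact: factorizations_uniq.
by move=> [i u] [j v] _ _ /= [-> ->].
Qed.

Lemma sum_triples (F : int -> nat * nat -> int) n :
  \sum_(q <- triples n) F q.1 q.2 =
  \sum_(i <- ints n) \sum_(u <- factorizations (n - `|i| ^ 2)) F i u.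
Proof. by rewrite big_allpairs_dep. Qed.

(** The condition [g 0 = 0] removes the integers [i] with [i^2 > n], for which the truncated
    difference is [0]. *)
Lemma theta_sigmaM (w : nat -> int) (g : fps int) n : g 0%N = 0 ->
  (((fun m => w m * theta m) : fps int) * g) n =
  \sum_(i <- ints n) w (`|i| ^ 2)%N * g (n - `|i| ^ 2)%N.
Proof.
move=> g0; rewrite fpsM.
transitivity (\sum_(m < n.+1) \sum_(i <- ints n)
    if (`|i| ^ 2 == m)%N then w (`|i| ^ 2)%N * g (n - `|i| ^ 2)%N else 0).
  apply: eq_bigr => m _.
  have le_mn : (m <= n)%N by rewrite -ltnS.
  rewrite (theta_sum le_mn) mulr_sumr mulr_suml big_mkcond /=.
  by apply: eq_bigr => i _; case: eqP => // ->; rewrite mulr1.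
rewrite exchange_big /=; apply: eq_bigr => i _; rewrite -big_mkcond /=.
have [le_in|lt_ni] := leqP (`|i| ^ 2) n.
- rewrite (big_pred1 (Ordinal (le_in : (`|i| ^ 2 < n.+1)%N))) // => m.
- have -> : (n - `|i| ^ 2 = 0)%N by move: lt_ni; set z := (_ ^ _)%N; lia.
  rewrite g0 mulr0 big_pred0 // => m; apply/negbTE.
  by rewrite neq_ltn orbC (leq_trans (ltn_ord m) lt_ni).
Qed.

(* The sum over the triples [(i, d, e)] of [(d * e - 4 * i ^ 2) * (d + e)] does not
   change when [i * (e ^ 2 - d ^ 2)], which is odd in [i], is added; the summand
   becomes [G := (d + e) * (e - 2 * i) * (d + 2 * i)], invariant under
   [(- i, e, d)] and negated on [e > d + 2 * i] by [(- i - d, d, e - 2 * i - d)]. *)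
Lemma sum_triples_boundary n :
  \sum_(q <- triples n)
    (q.2.1%:Z * q.2.2%:Z - 4 * q.1 ^+ 2) * (q.2.1%:Z + q.2.2%:Z) =
  \sum_(q <- triples n | q.2.2%:Z == q.2.1%:Z + 2 * q.1)
    (q.2.1%:Z + q.2.2%:Z) * q.2.1%:Z * q.2.2%:Z.
Proof.
pose G (q : int * (nat * nat)) : int :=
  (q.2.1%:Z + q.2.2%:Z) * (q.2.2%:Z - 2 * q.1) * (q.2.1%:Z + 2 * q.1).
have odd0 : \sum_(q <- triples n) q.1 * (q.2.2%:Z ^+ 2 - q.2.1%:Z ^+ 2) * 2 = 0.
  apply: (@big_anti_involution _ _ xpredT (fun q => (- q.1, q.2))); first exact: triples_uniq.
  move=> [i [d e]]; rewrite !mem_triples /= sqrrN => -> _.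
  by split=> //; [rewrite opprK | ring].
transitivity (\sum_(q <- triples n) G q).
  rewrite -[LHS]addr0 -[X in _ + X]odd0 -big_split; apply: eq_bigr => -[i [d e]] _.
  by rewrite /G /=; ring.
have gt0 : \sum_(q <- triples n | q.2.1%:Z + 2 * q.1 < q.2.2%:Z) G q = 0.
  pose tau (q : int * (nat * nat)) : int * (nat * nat) :=
    (- q.1 - q.2.1%:Z, (q.2.1, absz (q.2.2%:Z - 2 * q.1 - q.2.1%:Z)%R)).
  apply: (@big_anti_involution _ _ _ tau).
    exact: triples_uniq.
  move=> [i [d e]]; rewrite !mem_triples /= => /and3P[d0 e0 /eqP E] lt.
  have eE : (absz (e%:Z - 2 * i - d%:Z)%R)%:Z = e%:Z - 2 * i - d%:Z by lia.
  split.
  - rewrite d0 /=; apply/andP; split; first by lia.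
    by apply/eqP; rewrite eE -E; ring.
  - rewrite eE; lia.
  - by rewrite /tau /= eE; congr (_, (_, _)); lia.
  - by rewrite /G /= eE; ring.
have lt0 : \sum_(q <- triples n | q.2.2%:Z < q.2.1%:Z + 2 * q.1) G q = 0.
  rewrite (@big_involution _ _ _ (fun q => q.2.1%:Z + 2 * q.1 < q.2.2%:Z) _
    (fun q => (- q.1, (q.2.2, q.2.1)))) ?triples_uniq //.
  - by rewrite -[RHS]gt0; apply: eq_bigr => -[i [d e]] _; rewrite /G /=; ring.
  - move=> [i [d e]]; rewrite !mem_triples /= sqrrN opprK => /and3P[-> -> +] h.
    by rewrite mulrC => ->; split=> //; lia.
  - move=> [i [d e]]; rewrite !mem_triples /= sqrrN opprK => /and3P[-> -> +] h.
    by rewrite mulrC => ->; split=> //; lia.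
rewrite (bigID (fun q : int * (nat * nat) => q.2.1%:Z + 2 * q.1 < q.2.2%:Z)) /= gt0 add0r.
rewrite (bigID (fun q : int * (nat * nat) => q.2.2%:Z < q.2.1%:Z + 2 * q.1)) /=.
rewrite [X in X + _](_ : _ = 0) ?add0r; last first.
  by rewrite -[RHS]lt0; apply: eq_bigl => -[i [d e]] /=; lia.
apply: eq_big => [[i [d e]] /=|[i [d e]] /= h]; first by lia.
rewrite /G /=.
have -> : e%:Z = d%:Z + 2 * i by lia.
ring.
Qed.

(** Since [n - 5 i^2 = d e - 4 i^2], symmetrizing in [d] and [e] gives twice the sum on the left of
    [sum_triples_boundary]. On the boundary [e = d + 2 i] one has [n = (d + i)^2], so nothing
    remains unless [n = s^2]; then [i = s - d], [e = 2 s - d] with [0 < d < 2 s], and the sum of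
    [2 s d (2 s - d)] is elementary. *)
Lemma sum_triples_theta n :
  6 * \sum_(q <- triples n) (n%:Z - 5 * q.1 ^+ 2) * q.2.1%:Z =
  n%:Z * (4 * n%:Z - 1) * theta n.
Proof.
have e1 : 2 * \sum_(q <- triples n) (n%:Z - 5 * q.1 ^+ 2) * q.2.1%:Z =
    \sum_(q <- triples n)
      (q.2.1%:Z * q.2.2%:Z - 4 * q.1 ^+ 2) * (q.2.1%:Z + q.2.2%:Z).
  have -> : \sum_(q <- triples n)
      (q.2.1%:Z * q.2.2%:Z - 4 * q.1 ^+ 2) * (q.2.1%:Z + q.2.2%:Z) =
    \sum_(q <- triples n) (n%:Z - 5 * q.1 ^+ 2) * q.2.1%:Z +
    \sum_(q <- triples n) (n%:Z - 5 * q.1 ^+ 2) * q.2.2%:Z.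
    rewrite -big_split; apply: eq_big_seq => -[i [d e]]; rewrite mem_triples /=.
    move=> /and3P[_ _ /eqP E].
    rewrite -E; ring.
  rewrite [X in _ = _ + X](@big_involution _ _ _ xpredT xpredT (fun q => (q.1, (q.2.2, q.2.1))));
    first by rewrite mulr_natl mulr2n.
  - exact: triples_uniq.
  - by move=> [i [d e]]; rewrite !mem_triples /= mulrC => /and3P[-> -> ->].
  - by move=> [i [d e]]; rewrite !mem_triples /= mulrC => /and3P[-> -> ->].
have -> (x : int) : 6 * x = 3 * (2 * x) by ring.
rewrite e1 sum_triples_boundary.
have [[s es]|nsq] := pselect (exists s, s ^ 2 = n)%N; last first.
  rewrite theta_nsquare // mulr0 big_seq_cond big_pred0 ?mulr0 // => -[i [d e]] /=.
  apply/negP; rewrite mem_triples => /andP[/and3P[d0 e0 /eqP E] /eqP ede].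
  apply: nsq; exists (absz (d%:Z + i)%R).
  by apply/eqP; rewrite -eqz_nat absz_sqr -E ede; apply/eqP; ring.
have [s0|s_gt0] := posnP s.
  by move: es; rewrite s0 => <-; rewrite big_nil mulr0 !mul0r.
rewrite -es theta_square // es -big_filter.
rewrite (perm_big [seq (s%:Z - d%:Z, (d, s.*2 - d)%N) | d <- index_iota 0 s.*2 & (0 < d)%N]);
    last first.
  apply: uniq_perm; first by rewrite filter_uniq ?triples_uniq.
    by rewrite map_inj_uniq ?filter_uniq ?iota_uniq // => d e [].
  move=> [i [d e]]; rewrite mem_filter mem_triples /=; apply/idP/mapP.
    move=> /andP[/eqP ede /and3P[d0 e0 /eqP E]].
    have eds : d%:Z + i = s%:Z by move: E; rewrite -es ede; nia.
    exists d; first by rewrite mem_filter d0 mem_index_iota /=; lia.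
    by congr (_, (_, _)); lia.
  move=> [x]; rewrite mem_filter mem_index_iota => /andP[x0 /= hx] [-> -> ->].
  rewrite x0 subn_gt0 hx /=; apply/andP; split; apply/eqP; first by lia.
  by rewrite -es; nia.
rewrite big_map big_filter.
have h k : 6 * \sum_(0 <= d < k) d%:Z * (s.*2%:Z - d%:Z) =
    3 * s.*2%:Z * k%:Z * (k%:Z - 1) - k%:Z * (k%:Z - 1) * (2 * k%:Z - 1).
  elim: k => [|k IH]; first by rewrite big_nil; ring.
  rewrite big_nat_recr //= mulrDr IH; have -> : k.+1%:Z = k%:Z + 1 by lia.
  by ring.
have -> : \sum_(d <- index_iota 0 s.*2 | (0 < d)%N)
    (d%:Z + (s.*2 - d)%N%:Z) * d%:Z * (s.*2 - d)%N%:Z =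
    s.*2%:Z * \sum_(0 <= d < s.*2) d%:Z * (s.*2%:Z - d%:Z).
  rewrite mulr_sumr big_mkcond; apply: eq_big_nat => d hd.
  have -> : (s.*2 - d)%N%:Z = s.*2%:Z - d%:Z by lia.
  by case: posnP => [->|_]; ring.
have -> (x : int) : 3 * (s.*2%:Z * x) = s%:Z * (6 * x) by rewrite -muln2 PoszM; ring.
rewrite h -es -mulnn PoszM -muln2 PoszM; ring.
Qed.

(** * Differential equations *)

Lemma fps_ext (R : Type) (f g : fps R) : (forall n, f n = g n) -> f = g.
Proof. by move=> h; apply/funext. Qed.

(** Used to derive an equation from hypotheses: its difference of sides is written as a combination
    of theirs, with cofactors checked by [ring]. *)
Lemma lincomb1 (R : comNzRingType) (a A B : R) : A = B -> a * (A - B) = 0.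
Proof. by move=> ->; rewrite subrr mulr0. Qed.

Lemma lincomb2 (R : comNzRingType) (a b A B C D : R) :
  A = B -> C = D -> a * (A - B) + b * (C - D) = 0.
Proof. by move=> -> ->; rewrite !subrr !mulr0 addr0. Qed.

Definition E2 : fps int := 1 - 24 * sigma 1.
Definition E4 : fps int := 1 + 240 * sigma 3.
Definition E6 : fps int := 1 - 504 * sigma 5.

Lemma fpsD1_natM (R : comNzRingType) k (f : fps R) : fpsD1 (k%:R * f) = k%:R * fpsD1 f.
Proof. by rewrite fpsD1M fpsD1_nat mul0r add0r. Qed.

Lemma fpsD1_1 (R : comNzRingType) : fpsD1 (1 : fps R) = 0.
Proof. exact: (fpsD1_nat R 1). Qed.

Lemma ramanujan2 : 12 * fpsD1 E2 = E2 ^+ 2 - E4.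
Proof.
have h : 12 * (sigma 1 * sigma 1) = 5 * sigma 3 + sigma 1 - 6 * fpsD1 (sigma 1).
  apply: fps_ext => n.
  rewrite fpsB fpsD !fpsMnatl sigmaM11 fpsD1E.
  by rewrite (natz n) !mulrA.
rewrite /E2 /E4 fpsD1B fpsD1_natM fpsD1_1; apply: subr0_eq.
transitivity (- 48 * (12 * (sigma 1 * sigma 1) -
  (5 * sigma 3 + sigma 1 - 6 * fpsD1 (sigma 1)))); first by ring.
exact: lincomb1 h.
Qed.

Lemma ramanujan4 : 3 * fpsD1 E4 = E2 * E4 - E6.
Proof.
have h : 240 * (sigma 1 * sigma 3) =
    21 * sigma 5 + 10 * sigma 3 - 30 * fpsD1 (sigma 3) - sigma 1.
  apply: fps_ext => n.
  by rewrite !fpsB fpsD !fpsMnatl sigmaM13 fpsD1E (natz n) !mulrA.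
rewrite /E2 /E4 /E6 fpsD1D fpsD1_natM fpsD1_1; apply: subr0_eq.
transitivity (24 * (240 * (sigma 1 * sigma 3) -
  (21 * sigma 5 + 10 * sigma 3 - 30 * fpsD1 (sigma 3) - sigma 1))); first by ring.
exact: lincomb1 h.
Qed.

(** The sum [sigma 7] is eliminated between the convolutions of [sigma 1] with [sigma 5] and of
    [sigma 3] with itself. *)
Lemma ramanujan6 : 2 * fpsD1 E6 = E2 * E6 - E4 ^+ 2.
Proof.
have h5 : 504 * (sigma 1 * sigma 5) =
    20 * sigma 7 + 21 * sigma 5 - 42 * fpsD1 (sigma 5) + sigma 1.
  apply: fps_ext => n.
  by rewrite fpsD fpsB fpsD !fpsMnatl sigmaM15 fpsD1E (natz n) !mulrA.
have h3 : 120 * (sigma 3 * sigma 3) = sigma 7 - sigma 3.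
  by apply: fps_ext => n; rewrite fpsB !fpsMnatl sigmaM33.
rewrite /E2 /E4 /E6 fpsD1B fpsD1_natM fpsD1_1; apply: subr0_eq.
transitivity (- 24 * (504 * (sigma 1 * sigma 5) -
  (20 * sigma 7 + 21 * sigma 5 - 42 * fpsD1 (sigma 5) + sigma 1)) +
  480 * (120 * (sigma 3 * sigma 3) - (sigma 7 - sigma 3))); first by ring.
exact: lincomb2 h5 h3.
Qed.

(** At order [n] both convolutions are sums over [i^2 + d e = n]: differentiating [theta] brings the
    factor [i^2], differentiating [sigma 1] brings [d e = n - i^2]. Together they give the weight
    [(n - 5 i^2) d] of [sum_triples_theta]. *)
Lemma theta_ode :
  16 * fpsD1 (fpsD1 theta) = 4 * (E2 * fpsD1 theta) - fpsD1 E2 * theta.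
Proof.
apply: fps_ext => n.
have e1 : (fpsD1 theta * sigma 1) n = \sum_(q <- triples n) q.1 ^+ 2 * q.2.1%:Z.
  have -> : fpsD1 theta = (fun m => m%:Z * theta m).
    by apply: fps_ext => m; rewrite fpsD1E natz.
  rewrite (theta_sigmaM (fun m => m%:Z) n (sigma0 1)).
  rewrite (sum_triples (fun i u => i ^+ 2 * u.1%:Z)); apply: eq_bigr => i _.
  by rewrite absz_sqr /sigma mulr_sumr; apply: eq_bigr => u _; rewrite expr1.
have e2 : (theta * fpsD1 (sigma 1)) n =
    \sum_(q <- triples n) (n%:Z - q.1 ^+ 2) * q.2.1%:Z.
  have -> : theta = (fun m => (fun=> 1) m * theta m).
    by apply: fps_ext => m; rewrite mul1r.
  rewrite theta_sigmaM; last by rewrite /fpsD1 mulr0n.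
  rewrite (sum_triples (fun i u => (n%:Z - i ^+ 2) * u.1%:Z)); apply: eq_bigr => i _.
  rewrite mul1r fpsD1E (natz (n - _)) /sigma !mulr_sumr; apply: eq_big_seq => -[d e].
  rewrite mem_factorizations => /and3P[d0 e0 /eqP E].
  have de0 : (0 < d * e)%N by rewrite muln_gt0 d0.
  rewrite /= expr1 -absz_sqr; congr (_ * _).
  by move: E de0; set z := (_ * _)%N; set w := (_ ^ _)%N; lia.
have e3 : \sum_(q <- triples n) (n%:Z - q.1 ^+ 2) * q.2.1%:Z -
    4 * \sum_(q <- triples n) q.1 ^+ 2 * q.2.1%:Z =
    \sum_(q <- triples n) (n%:Z - 5 * q.1 ^+ 2) * q.2.1%:Z.
  by rewrite mulr_sumr -sumrB; apply: eq_bigr => q _; ring.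
have -> : 4 * (E2 * fpsD1 theta) - fpsD1 E2 * theta =
    4 * fpsD1 theta + 24 * (theta * fpsD1 (sigma 1) - 4 * (fpsD1 theta * sigma 1)).
  by rewrite /E2 fpsD1B fpsD1_natM fpsD1_1; ring.
rewrite fpsD !fpsMnatl fpsB fpsMnatl e1 e2 e3 !fpsD1E (natz n).
have := sum_triples_theta n; set S := (\sum_(q <- _) _) => h.
have -> : 24 * S = 4 * (6 * S) by ring.
rewrite h; ring.
Qed.

(** * Parametrization by the theta series modulo p *)

Lemma fpsM_lead (R : comNzRingType) (f g : fps R) n :
  (forall i, (i < n)%N -> g i = 0) -> (f * g) n = f 0%N * g n.
Proof.
move=> hg; rewrite fpsM big_ord_recl subn0 big1 ?addr0 // => i _.
by rewrite hg ?mulr0 // lift0; have := ltn_ord i; lia.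
Qed.

Lemma fpsX_low (R : comNzRingType) (h : fps R) k n : h 0%N = 0 -> (n < k)%N -> (h ^+ k) n = 0.
Proof. by move=> h0 lt_nk; rewrite (fps_shift h0) exprMn fpsXnM lt_nk. Qed.

(** The geometric series in [h = 1 - f]; as [h] has no constant term, its powers beyond the [n]-th
    do not reach the coefficient at [n]. *)
Lemma fps_inv (R : comNzRingType) (f : fps R) : f 0%N = 1 -> exists g, f * g = 1.
Proof.
move=> f0; pose h : fps R := 1 - f.
have h0 : h 0%N = 0 by rewrite /h fpsB f0 subrr.
exists (fun n => (\sum_(k < n.+1) h ^+ k) n); apply: fps_ext => n.
transitivity ((f * \sum_(k < n.+1) h ^+ k) n).
  rewrite !fpsM; apply: eq_bigr => i _; congr (_ * _).
  have le_n : (n - i <= n)%N by exact: leq_subr.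
  move: (n - i)%N le_n => j le_jn.
  rewrite !fps_sum (big_ord_widen n.+1 (fun k => (h ^+ k) j)) //.
  rewrite [LHS]big_mkcond; apply: eq_bigr => k _; case: ltnP => // lt_jk.
  by rewrite fpsX_low.
have -> : f * (\sum_(k < n.+1) h ^+ k) = 1 - h ^+ n.+1.
  by rewrite -opprB subrX1 /h; ring.
by rewrite fpsB fpsX_low // subr0.
Qed.

Definition Q4 (S : comNzRingType) (x y : S) := x ^+ 2 + 14 * x * y + y ^+ 2.
Definition Q6 (S : comNzRingType) (x y : S) := (x + y) * (x ^+ 2 - 34 * x * y + y ^+ 2).
(** At [(s^4, t^4)] this is the fourth power of [s t (s^4 - t^4)], whose zeros are the six vertices
    of the octahedron. At the theta values it is [16 Delta], because [1728 = 108 * 16]. *)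
Definition Q12 (S : comNzRingType) (x y : S) := x * y * (x - y) ^+ 4.

Lemma Q4_Q6 (S : comNzRingType) (x y : S) : Q4 x y ^+ 3 - Q6 x y ^+ 2 = 108 * Q12 x y.
Proof. by rewrite /Q4 /Q6 /Q12; ring. Qed.

Lemma fpsD1_sqr (R : comNzRingType) (f : fps R) : fpsD1 (f ^+ 2) = 2 * f * fpsD1 f.
Proof. exact: fpsD1X. Qed.

Lemma fps_natI (F : fieldType) k (f g : fps F) :
  k%:R != 0 :> F -> k%:R * f = k%:R * g -> f = g.
Proof.
move=> k0 e; apply: fps_ext => n; apply: (mulfI k0).
by rewrite -(fpsMnatl k f) e fpsMnatl.
Qed.

Section ThetaParametrization.
Variables (F : fieldType) (e2 e4 e6 th : fps F) (m : nat).
Hypotheses (r2 : 12 * fpsD1 e2 = e2 ^+ 2 - e4) (r4 : 3 * fpsD1 e4 = e2 * e4 - e6)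
  (r6 : 2 * fpsD1 e6 = e2 * e6 - e4 ^+ 2)
  (ode : 16 * fpsD1 (fpsD1 th) = 4 * (e2 * fpsD1 th) - fpsD1 e2 * th).
Hypotheses (e2_0 : e2 0%N = 1) (e2_1 : e2 1%N = - 24) (e4_0 : e4 0%N = 1) (e6_0 : e6 0%N = 1)
  (th_0 : th 0%N = 1) (th_1 : th 1%N = 2).
Hypotheses (F2 : 2 != 0 :> F) (F3 : 3 != 0 :> F) (F5 : 5 != 0 :> F)
  (Fm : forall N, (0 < N < m)%N -> N%:R != 0 :> F /\ 4 * N%:R - 1 != 0 :> F).

(** The differences [d4] and [d6] between the Eisenstein series and [Q4], [Q6] satisfy a homogeneous
    linear differential system; its recursion for the coefficients is nonsingular below [m], so they
    vanish there. *)
Lemma theta_parametrization : exists x : fps F,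
  [/\ x 0%N = 0, x 1%N = 16, forall i, (i < m)%N -> e4 i = Q4 x (th ^+ 4) i
    & forall i, (i < m)%N -> e6 i = Q6 x (th ^+ 4) i].
Proof.
have [io thio] := fps_inv th_0.
pose y := th ^+ 4; pose u := fpsD1 th * io.
have thu : fpsD1 th = u * th by rewrite /u -mulrA [io * _]mulrC thio mulr1.
(* The true theta values satisfy [24 u = e2 + 5 x - y], with [u] the logarithmic derivative of [th];
   this is solved for [x]. *)
pose x := fpsC 5^-1 * (24 * u - e2 + y).
have x5 : 5 * x = 24 * u - e2 + y.
  have -> : 24 * u - e2 + y = 1 * (24 * u - e2 + y) by rewrite mul1r.
  rewrite /x mulrA; congr (_ * _); apply: fps_ext => n.
  by rewrite fpsMnatl /fpsC fps1; case: n => [|n] /=; rewrite ?mulr1n ?divff ?mulr0n ?mulr0.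
have Dy : fpsD1 y = 4 * y * u.
  by rewrite /y fpsD1X thu; ring.
have Du : 16 * (fpsD1 u + u ^+ 2) = 4 * (e2 * u) - fpsD1 e2.
  have h : fpsD1 (fpsD1 th) = (fpsD1 u + u ^+ 2) * th by rewrite {1}thu fpsD1M thu; ring.
  have : 16 * ((fpsD1 u + u ^+ 2) * th) = 4 * (e2 * (u * th)) - fpsD1 e2 * th.
    by rewrite -h -thu ode.
  move=> /(congr1 (fun f => f * io)).
  have -> : 16 * ((fpsD1 u + u ^+ 2) * th) * io = 16 * (fpsD1 u + u ^+ 2) * (th * io) by ring.
  have -> : (4 * (e2 * (u * th)) - fpsD1 e2 * th) * io =
    (4 * (e2 * u) - fpsD1 e2) * (th * io) by ring.
  by rewrite thio !mulr1.
have u24 : 24 * u = e2 + 5 * x - y by rewrite x5; ring.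
pose d4 := e4 - Q4 x y; pose d6 := e6 - Q6 x y.
have Dx5 : 5 * fpsD1 x = 24 * fpsD1 u - fpsD1 e2 + fpsD1 y.
  by rewrite -fpsD1_natM x5 fpsD1D fpsD1B fpsD1_natM.
(* The equation of [y] with [x] and [y] exchanged, up to the error [d4]. It combines the Riccati
   equation [Du], Ramanujan's equation for [e2] and the relation [u24]. *)
have Dx : 24 * fpsD1 x = 4 * x * (e2 + 5 * y - x) + d4.
  apply: (fps_natI F5).
  rewrite mulrCA Dx5 Dy; apply: subr0_eq.
  transitivity (36 * (16 * (fpsD1 u + u ^+ 2) - (4 * (e2 * u) - fpsD1 e2))
    + (- 5) * (12 * fpsD1 e2 - (e2 ^+ 2 - e4))
    + (6 * e2 + 4 * y - (24 * u + (e2 + 5 * x - y))) * (24 * u - (e2 + 5 * x - y))).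
    by rewrite /d4 /Q4; ring.
  by rewrite (lincomb2 _ _ Du r2) add0r; exact: lincomb1.
have Dy24 : 24 * fpsD1 y = 4 * y * (e2 + 5 * x - y).
  by rewrite Dy -u24; ring.
have Dd4 : 24 * fpsD1 d4 = 8 * (e2 * d4 - d6) - (2 * x + 14 * y) * d4.
  have -> : 24 * fpsD1 d4 = 8 * (3 * fpsD1 e4) - (2 * x + 14 * y) * (24 * fpsD1 x)
      - (14 * x + 2 * y) * (24 * fpsD1 y).
    by rewrite /d4 /Q4 !(fpsD1_nat, fpsD1_sqr, fpsD1B, fpsD1D, fpsD1M); ring.
  by rewrite r4 Dx Dy24 /d4 /d6 /Q4 /Q6; ring.
have Dd6 : 24 * fpsD1 d6 = 12 * (e2 * d6) - 12 * ((e4 + Q4 x y) * d4)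
   - (3 * x ^+ 2 - 66 * x * y - 33 * y ^+ 2) * d4.
  have -> : 24 * fpsD1 d6 = 12 * (2 * fpsD1 e6)
      - (3 * x ^+ 2 - 66 * x * y - 33 * y ^+ 2) * (24 * fpsD1 x)
      - (3 * y ^+ 2 - 66 * x * y - 33 * x ^+ 2) * (24 * fpsD1 y).
    by rewrite /d6 /Q6 !(fpsD1_nat, fpsD1_sqr, fpsD1B, fpsD1D, fpsD1M); ring.
  by rewrite r6 Dx Dy24 /d4 /d6 /Q4 /Q6; ring.
have y0 : y 0%N = 1 by rewrite /y fpsX0 th_0 expr1n.
have x0 : x 0%N = 0.
  apply: (mulfI F5); rewrite mulr0 -fpsMnatl x5 fpsD fpsB fpsMnatl y0 e2_0 /u fpsM0.
  by rewrite /fpsD1 mulr0n mul0r mulr0 sub0r addNr.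
have x1 : x 1%N = 16.
  have u0 : u 0%N = 0 by rewrite /u fpsM0 /fpsD1 mulr0n mul0r.
  have u1 : u 1%N = 2.
    have := congr1 (fun f : fps F => f 1%N) thu.
    rewrite /fpsD1 th_1 fpsM 2!big_ord_recl big_ord0 u0 th_0 mul0r add0r addr0 mulr1n.
    by rewrite mulr1 => ->.
  have y1 : y 1%N = 8.
    have := congr1 (fun f : fps F => f 1%N) Dy.
    rewrite /fpsD1 mulr1n -mulrA fpsMnatl fpsM 2!big_ord_recl big_ord0 /= u0 u1 y0.
    by move=> ->; ring.
  apply: (mulfI F5); rewrite -fpsMnatl x5 fpsD fpsB fpsMnatl u1 e2_1 y1; ring.
(* For [N > 0], if both differences vanish below [N], their coefficients [s] and [t] at [N] solve a
   linear system of determinant [144 N (4 N - 1)]. *)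
have hd N : (N < m)%N -> d4 N = 0 /\ d6 N = 0.
  elim/ltn_ind: N => N IH lt_Nm.
  have h4 i : (i < N)%N -> d4 i = 0 by move=> h; case: (IH i h (ltn_trans h lt_Nm)).
  have h6 i : (i < N)%N -> d6 i = 0 by move=> h; case: (IH i h (ltn_trans h lt_Nm)).
  case: N => [|N] in IH lt_Nm h4 h6 *.
    rewrite /d4 /d6 /Q4 /Q6 !(fpsB, fpsD, fpsM0, fpsX0) !fps_nat x0 y0 e4_0 e6_0 /=.
    by rewrite !muln1; split; ring.
  have c4 := congr1 (fun f : fps F => f N.+1) Dd4.
  have c6 := congr1 (fun f : fps F => f N.+1) Dd6.
  move: c4 c6; rewrite !fpsB !fpsMnatl !fpsB !fpsD1E !(fpsM_lead _ h4) !(fpsM_lead _ h6).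
  rewrite !(fpsB, fpsD, fpsM0, fpsX0) !fps_nat /Q4 !(fpsB, fpsD, fpsM0, fpsX0) !fps_nat.
  rewrite x0 y0 e4_0 e2_0 /= !muln1.
  rewrite !(mulr0, mul0r, expr0n, expr1n, add0r, addr0, subr0, mulr1, mul1r).
  move: (d4 N.+1) (d6 N.+1) => s t c4 c6.
  have [z0 z1] := Fm (lt_Nm : (0 < N.+1 < m)%N).
  move: (N.+1%:R : F) z0 z1 c4 c6 => z z0 z1 c4 c6.
  have e12 (w : F) : 12 * w = 0 -> w = 0.
    move/eqP; rewrite [12%:R](natrM F 4 3) (natrM F 2 2) !mulf_eq0.
    by rewrite (negPf F2) (negPf F3) /= => /eqP.
  have t0 : t = 0.
    have : 12 * (12 * (z * ((4 * z - 1) * t))) = 0.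
      transitivity (9 * (24 * (z * s) - (8 * (s - t) - 14 * s)) +
        (24 * z + 6) * (24 * (z * t) - (12 * t - 12 * ((1 + 1) * s) - (- 0 - 33) * s))).
        by ring.
      exact: lincomb2.
    by move=> /e12/e12/eqP; rewrite !mulf_eq0 (negPf z0) (negPf z1) => /eqP.
  (* With [t = 0] the second equation reads [9 s = 0]. *)
  split=> //; apply: e12; move: c6; rewrite t0 !mulr0 => c6.
  transitivity (- 4 * 3^-1 * (0 - (0 - 12 * ((1 + 1) * s) - (- 0 - 33) * s))); last exact: lincomb1.
  by field.
exists x; split=> // i /hd[h4 h6]; apply/eqP; rewrite -subr_eq0 -fpsB; exact/eqP.
Qed.
End ThetaParametrization.

(** * The octahedral form *)

Section Homogenization.
Variables (F S : comNzRingType) (io : {rmorphism F -> S}) (u v : S).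

(* The value at [(u, v)] of the form of degree [d] that dehomogenizes to [g]. *)
Definition homog (d : nat) (g : {poly F}) : S :=
  \sum_(i < d.+1) io g`_i * u ^+ i * v ^+ (d - i).

Lemma homogD d g h : homog d (g + h) = homog d g + homog d h.
Proof.
rewrite /homog -big_split; apply: eq_bigr => i _.
by rewrite coefD rmorphD !mulrDl.
Qed.

Lemma homogZ d c g : homog d (c *: g) = io c * homog d g.
Proof.
rewrite /homog mulr_sumr; apply: eq_bigr => i _.
by rewrite coefZ rmorphM !mulrA.
Qed.

Lemma homog0 d : homog d 0 = 0.
Proof. by rewrite /homog big1 // => i _; rewrite coef0 rmorph0 !mul0r. Qed.

Lemma homog_sum d I (r : seq I) (P : pred I) (G : I -> {poly F}) :
  homog d (\sum_(i <- r | P i) G i) = \sum_(i <- r | P i) homog d (G i).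
Proof. by rewrite (big_morph _ (homogD d) (homog0 d)). Qed.

Lemma homogXn d k : (k <= d)%N -> homog d 'X^k = u ^+ k * v ^+ (d - k).
Proof.
move=> le_kd; rewrite /homog (bigD1 (inord k)) //= big1 => [|i ne_ik].
  by rewrite inordK ?ltnS // coefXn eqxx rmorph1 mul1r addr0.
rewrite coefXn -(inj_eq val_inj) /= inordK ?ltnS // in ne_ik *.
by rewrite (negPf ne_ik) rmorph0 !mul0r.
Qed.

Lemma homogM d e (g h : {poly F}) : (size g <= d.+1)%N -> (size h <= e.+1)%N ->
  homog (d + e) (g * h) = homog d g * homog e h.
Proof.
move=> sg sh.
have eg : g = \sum_(i < d.+1) g`_i *: 'X^i.
  rewrite -[g in LHS]coefK poly_def (big_ord_widen d.+1 (fun i => g`_i *: 'X^i)) //.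
  rewrite big_mkcond; apply: eq_bigr => i _; case: ltnP => // lt_i.
  by rewrite nth_default ?scale0r.
have eh : h = \sum_(i < e.+1) h`_i *: 'X^i.
  rewrite -[h in LHS]coefK poly_def (big_ord_widen e.+1 (fun i => h`_i *: 'X^i)) //.
  rewrite big_mkcond; apply: eq_bigr => i _; case: ltnP => // lt_i.
  by rewrite nth_default ?scale0r.
rewrite {1}eg {1}eh mulr_suml homog_sum {2}/homog mulr_suml; apply: eq_bigr => i _.
rewrite mulr_sumr homog_sum {2}/homog mulr_sumr; apply: eq_bigr => j _.
rewrite -scalerAl -scalerAr scalerA -exprD homogZ homogXn; last first.
  by rewrite leq_add // -ltnS.
have -> : (d + e - (i + j) = (d - i) + (e - j))%N by have := ltn_ord i; have := ltn_ord j; lia.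
rewrite rmorphM !exprD; ring.
Qed.

(** The degree bound travels with the value because [homogM] requires it. *)
Definition is_homog d (g : {poly F}) w := (size g <= d.+1)%N /\ homog d g = w.

Lemma is_homogX : is_homog 1 'X u.
Proof. by split; [rewrite size_polyX | rewrite -['X]expr1 homogXn // subnn mulr1]. Qed.
Lemma is_homog1 : is_homog 1 1 v.
Proof.
split; first by rewrite size_poly1.
by rewrite -[1](expr0 'X) homogXn // subn0 mul1r.
Qed.
Lemma is_homogC c : is_homog 0 c%:P (io c).
Proof.
split; first by rewrite size_polyC; case: eqP.
by rewrite /homog big_ord1 coefC mulr1 mulr1.
Qed.
Lemma is_homogD d g h w z : is_homog d g w -> is_homog d h z -> is_homog d (g + h) (w + z).
Proof.
move=> [sg <-] [sh <-]; split; last exact: homogD.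
by rewrite (leq_trans (size_polyD _ _)) // geq_max sg.
Qed.
Lemma is_homogM d e g h w z :
  is_homog d g w -> is_homog e h z -> is_homog (d + e) (g * h) (w * z).
Proof.
move=> [sg <-] [sh <-]; split; last exact: homogM.
by rewrite (leq_trans (size_polyMleq _ _)) //; lia.
Qed.
Lemma is_homogX_exp d g w k : is_homog d g w -> is_homog (d * k) (g ^+ k) (w ^+ k).
Proof.
move=> h; elim: k => [|k IH].
  by have := is_homogC 1; rewrite !rmorph1 muln0 !expr0.
by rewrite mulnS !exprS; exact: is_homogM.
Qed.
Lemma is_homog_nat k : is_homog 0 k%:R k%:R.
Proof. by have := is_homogC k%:R; rewrite polyC_natr rmorph_nat. Qed.
Lemma is_homogN d g w : is_homog d g w -> is_homog d (- g) (- w).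
Proof.
move=> [sg <-]; split; first by rewrite size_polyN.
by rewrite -scaleN1r homogZ rmorphN1 mulN1r.
Qed.
Lemma is_homog_sum d n (G : 'I_n -> {poly F}) (W : 'I_n -> S) :
  (forall i, is_homog d (G i) (W i)) -> is_homog d (\sum_i G i) (\sum_i W i).
Proof.
move=> h; elim/big_rec2: _ => [|i w g _ hg]; last exact: is_homogD.
by split; [rewrite size_poly0 | exact: homog0].
Qed.

Lemma is_homogQ4 : is_homog 2 (Q4 'X 1) (Q4 u v).
Proof.
have hX := is_homogX; have h1 := is_homog1.
apply: is_homogD; first apply: is_homogD.
- exact: (is_homogX_exp 2 hX).
- exact: (is_homogM (is_homogM (is_homog_nat 14) hX) h1).
- exact: (is_homogX_exp 2 h1).
Qed.
Lemma is_homogQ6 : is_homog 3 (Q6 'X 1) (Q6 u v).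
Proof.
have hX := is_homogX; have h1 := is_homog1.
apply: (@is_homogM 1 2); first exact: is_homogD.
apply: is_homogD; first apply: is_homogD.
- exact: (is_homogX_exp 2 hX).
- apply: is_homogN; exact: (is_homogM (is_homogM (is_homog_nat 34) hX) h1).
- exact: (is_homogX_exp 2 h1).
Qed.
Lemma is_homogQ12 : is_homog 6 (Q12 'X 1) (Q12 u v).
Proof.
have hX := is_homogX; have h1 := is_homog1.
apply: (@is_homogM 2 4); first exact: is_homogM hX h1.
apply: (is_homogX_exp 4 (d := 1)); apply: is_homogD => //; exact: is_homogN.
Qed.

End Homogenization.

(* The form of weight [12 * n + 4 * a + 6 * b] with coefficients [c], in terms of the
   fourth powers of the thetas: [x] and [y] stand for [theta_2 ^ 4] and [theta_3 ^ 4]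
   at [2 * tau]. *)
Definition octa (F S : comNzRingType) (io : F -> S) (c : nat -> F) n a b (x y : S) : S :=
  \sum_(i < n.+1) io (c i) * Q4 x y ^+ (3 * i + a) * Q6 x y ^+ b * Q12 x y ^+ (n - i).

Lemma is_homog_octa (F S : comNzRingType) (io : {rmorphism F -> S}) c n a b (u v : S) :
  is_homog io u v (6 * n + 2 * a + 3 * b) (octa polyC c n a b 'X 1) (octa io c n a b u v).
Proof.
apply: is_homog_sum => i.
have -> : (6 * n + 2 * a + 3 * b = 0 + 2 * (3 * i + a) + 3 * b + 6 * (n - i))%N.
  by have := ltn_ord i; lia.
apply: is_homogM; last exact: is_homogX_exp (is_homogQ12 _ _ _).
apply: is_homogM; last exact: is_homogX_exp (is_homogQ6 _ _ _).
apply: is_homogM; last exact: is_homogX_exp (is_homogQ4 _ _ _).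
exact: is_homogC.
Qed.

Lemma octaC (F S : comNzRingType) (io : F -> S) c n a b (x y : S) :
  octa io c n a b x y = octa io c n a b y x.
Proof.
rewrite /octa; apply: eq_bigr => i _.
have -> : Q4 y x = Q4 x y by rewrite /Q4; ring.
have -> : Q6 y x = Q6 x y by rewrite /Q6; ring.
by have -> : Q12 y x = Q12 x y by rewrite /Q12; ring.
Qed.

(** The map [t -> (1 - t) / (1 + t)] is a symmetry of the octahedron that exchanges the vertices [0]
    and [1]. It multiplies [Q4], [Q6], [Q12] at fourth powers by [2^4], [- 2^6], [2^12]. *)
Lemma octa_moebius (F S : comNzRingType) (io : F -> S) c n a b (t : S) :
  octa io c n a b ((1 - t) ^+ 4) ((1 + t) ^+ 4) =
  (-1) ^+ b * 2 ^+ (12 * n + 4 * a + 6 * b) * octa io c n a b (t ^+ 4) 1.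
Proof.
rewrite /octa mulr_sumr; apply: eq_bigr => i _.
have -> : Q4 ((1 - t) ^+ 4) ((1 + t) ^+ 4) = 2 ^+ 4 * Q4 (t ^+ 4) 1 by rewrite /Q4; ring.
have -> : Q6 ((1 - t) ^+ 4) ((1 + t) ^+ 4) = - 2 ^+ 6 * Q6 (t ^+ 4) 1 by rewrite /Q6; ring.
have -> : Q12 ((1 - t) ^+ 4) ((1 + t) ^+ 4) = 2 ^+ 12 * Q12 (t ^+ 4) 1 by rewrite /Q12; ring.
have -> : (12 * n + 4 * a + 6 * b = 4 * (3 * i + a) + 6 * b + 12 * (n - i))%N.
  by have := ltn_ord i; lia.
move: (Q4 _ _) (Q6 _ _) (Q12 _ _) (3 * i + a)%N (n - i)%N => A B C e f.
rewrite [(2 ^+ 4 * A) ^+ e]exprMn [(2 ^+ 12 * C) ^+ f]exprMn [(- 2 ^+ 6 * B) ^+ b]exprMn.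
rewrite [(- 2 ^+ 6) ^+ b]exprNn -!exprM.
rewrite (exprD 2 (4 * e + 6 * b) (12 * f)) (exprD 2 (4 * e)).
move: (2 ^+ (4 * e)) (2 ^+ (6 * b)) (2 ^+ (12 * f)) => A2 B2 C2.
move: (io (c i)) (A ^+ e) (B ^+ b) (C ^+ f) ((-1) ^+ b) => *; ring.
Qed.

Section OctaInvariance.
Variables (F : fieldType) (c : nat -> F) (n a b m : nat).
Hypotheses (em : m = (6 * n + 2 * a + 3 * b)%N) (lt_ab : (2 * a + 3 * b < 6)%N) (m_gt0 : (0 < m)%N).
Hypothesis F2 : 2 != 0 :> F.
Hypothesis frob : forall t : {poly F},
  (1 - t) ^+ (4 * m) + (1 + t) ^+ (4 * m) = 2 * (t ^+ (4 * m) + 1).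
Hypothesis scal : (-1) ^+ b * 2 ^+ (12 * n + 4 * a + 6 * b) = 2 :> F.

(** By [scal] and [frob] both terms of the difference acquire the same factor [2] under
    [t -> (1 - t) / (1 + t)], so that the order of vanishing at one vertex spreads to the others. *)
Let g : {poly F} := octa polyC c n a b 'X 1 - ('X^m + 1).

Hypothesis g_low : ('X ^+ n.+1 %| g)%R.

Lemma homog_octa_defect (S : comNzRingType) (io : {rmorphism F -> S}) (u v : S) :
  homog io u v m g = octa io c n a b u v - (u ^+ m + v ^+ m).
Proof.
have h := is_homog_octa io c n a b u v; rewrite -em in h.
have hm : is_homog io u v m ('X^m + 1) (u ^+ m + v ^+ m).
  apply: is_homogD; first by have := is_homogX_exp m (is_homogX io u v); rewrite mul1n.
  by have := is_homogX_exp m (is_homog1 io u v); rewrite mul1n expr1n.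
by case: (is_homogD h (is_homogN hm)).
Qed.

Lemma size_octa_defect : (size g <= m.+1)%N.
Proof.
have h := is_homog_octa polyC c n a b ('X : {poly F}) 1; rewrite -em in h.
have hm : is_homog polyC 'X (1 : {poly F}) m ('X^m + 1) ('X^m + 1).
  have hX := is_homogX_exp m (is_homogX polyC ('X : {poly F}) 1).
  have h1 := is_homogX_exp m (is_homog1 polyC ('X : {poly F}) 1).
  by rewrite !mul1n in hX h1; have := is_homogD hX h1; rewrite expr1n.
by case: (is_homogD h (is_homogN hm)).
Qed.

Lemma octa_defect_sym i : (i <= m)%N -> g`_(m - i) = g`_i.
Proof.
move=> le_im.
have e : g = homog polyC 1 'X m g.
  by rewrite homog_octa_defect octaC [1 ^+ m + _]addrC expr1n.
rewrite [in RHS]e /homog coef_sum (bigD1 (inord (m - i))) //= big1 => [|j ne_j].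
  rewrite inordK ?ltnS ?leq_subr // expr1n mulr1 subKn // coefCM coefXn eqxx mulr1 addr0 //.
rewrite expr1n mulr1 coefCM coefXn; case: eqP => [ej|]; rewrite ?mulr0 //.
case/eqP: ne_j; apply: val_inj; rewrite /= inordK ?ltnS ?leq_subr // ej subKn // -ltnS.
by have := ltn_ord j; lia.
Qed.

(** Vanishing to order [n + 1] at [0] becomes, by the symmetry of the coefficients, vanishing to
    that order at infinity. *)
Lemma size_octa_defect_low : (size g <= m - n)%N.
Proof.
apply/leq_sizeP => j le_j.
have [lt_mj|le_jm] := ltnP m j; first by rewrite nth_default // (leq_trans size_octa_defect).
have -> : j = (m - (m - j))%N by rewrite subKn.
rewrite octa_defect_sym ?leq_subr //; case/dvdpP: g_low => q ->.
by rewrite coefMXn; case: ltnP => //; lia.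
Qed.

(** The zero of [g (t^4)] of order [4 (n + 1)] at the vertex [0] is carried to the vertex [1]. *)
Lemma octa_defect_comp_dvd : (('X - 1) ^+ (4 * n.+1) %| g \Po 'X^4)%R.
Proof.
have eg : homog polyC ('X^4 : {poly F}) 1 m g = g \Po 'X^4.
  rewrite comp_polyE /homog (big_ord_widen m.+1 (fun i => g`_i *: 'X^4 ^+ i)) ?size_octa_defect //.
  rewrite [RHS]big_mkcond; apply: eq_bigr => i _; case: ltnP => [_|lt_i].
    by rewrite expr1n mulr1 mul_polyC.
  by rewrite nth_default // !mul0r.
have e2 : homog polyC ((1 - 'X) ^+ 4) ((1 + 'X) ^+ 4) m g = 2 * (g \Po 'X^4).
  rewrite homog_octa_defect octa_moebius -!exprM frob -eg homog_octa_defect expr1n -exprM.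
  have -> : (-1) ^+ b * 2 ^+ (12 * n + 4 * a + 6 * b) = 2 :> {poly F}.
    by rewrite -[2 in RHS](rmorph_nat polyC) -scal rmorphM !rmorphXn rmorphN1 rmorph_nat.
  by rewrite mulrBr.
have [g0|g_neq0] := eqVneq g 0; first by rewrite g0 comp_poly0 dvdp0.
case/dvdpP: g_low => q eq.
have dq : (('X - 1) ^+ (4 * n.+1) %| 2 * (g \Po 'X^4))%R.
  rewrite -e2 eq.
  (* Homogenization is multiplicative, and the factor [X^(n+1)] of [g] contributes
     [(1 - X)^(4 (n + 1))]. *)
  have em' : m = ((m - n.+1) + n.+1)%N by rewrite subnK //; lia.
  rewrite [X in homog _ _ _ X]em'.
  rewrite homogM ?size_polyXn //; last first.
    have : (size g <= m.+1)%N := size_octa_defect.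
    have q0 : q != 0 by apply: contraNneq g_neq0 => q0; rewrite eq q0 mul0r.
    rewrite eq size_mulXn // => hs.
    by rewrite -(leq_add2l n.+1) (leq_trans hs) // addnS addnC -em'.
  rewrite dvdp_mull // homogXn // subnn mulr1 -exprM.
  have -> : 1 - 'X = - ('X - 1) :> {poly F} by rewrite opprB.
  by rewrite exprNn dvdp_mull ?dvdpp.
by move: dq; rewrite -[2](rmorph_nat polyC) mul_polyC dvdpZr.
Qed.

(** As [t^4 - 1] has a simple zero at [1], the order of [g] at [1] is that of [g (t^4)], at least
    [4 (n + 1)]. With the orders [n + 1] at [0] and at infinity this would force [6 (n + 1) <= m]
    for [g != 0], whereas [m = 6 n + 2 a + 3 b < 6 (n + 1)]. *)
Lemma octa_eq0 : g = 0.
Proof.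
have [->//|g_neq0] := eqVneq g 0.
have [mu [q]] := multiplicity_XsubC g 1; rewrite g_neq0 /= => rq eq.
have q_neq0 : q != 0 by apply: contraNneq rq => ->; rewrite root0.
have le_mu : (4 * n.+1 <= mu)%N.
  rewrite leqNgt; apply/negP => lt_mu.
  have : (('X - 1) ^+ mu.+1 %| g \Po 'X^4)%R.
    by apply: dvdp_trans octa_defect_comp_dvd; rewrite dvdp_exp2l.
  rewrite eq comp_polyM rmorphXn /= comp_polyB comp_polyX comp_polyC.
  have -> : 'X^4 - 1%:P = ('X^3 + 'X^2 + 'X + 1) * ('X - 1) :> {poly F}.
    by rewrite polyC1; ring.
  rewrite exprMn mulrA exprS dvdp_mul2r; last first.
    by rewrite expf_neq0 // -polyC1 polyXsubC_eq0.
  rewrite -polyC1 dvdp_XsubCl rootM => /orP[].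
    rewrite /root horner_comp hornerXn expr1n -[_ == 0]/(root q 1).
    by rewrite (negPf rq).
  rewrite /root horner_exp !hornerE expf_eq0 => /andP[_].
  have -> : 1 ^+ 3 + 1 ^+ 2 + 1 + 1 = 2 * 2 :> F by ring.
  by rewrite mulf_eq0 (negPf F2).
have qX : ('X ^+ n.+1 %| q)%R.
  have := g_low; rewrite eq Gauss_dvdpl // coprimep_expl // coprimep_expr //.
  by rewrite coprimep_sym coprimepX root_XsubC eq_sym oner_eq0.
have [q2 eq2] := dvdpP _ _ qX.
have q2_neq0 : q2 != 0 by apply: contraNneq q_neq0 => q20; rewrite eq2 q20 mul0r.
exfalso; have := size_octa_defect_low; rewrite eq size_Mmonic ?monic_exp ?monicXsubC //.
rewrite size_exp_XsubC eq2 size_mulXn // addSn /=.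
have : (0 < size q2)%N by rewrite size_poly_gt0.
by move: lt_ab le_mu (size _); rewrite em; clear; lia.
Qed.
End OctaInvariance.

(** * Reduction modulo p *)

(** Since [x] has order exactly one and [y] starts with [1], the monomial with [x^i] starts at order
    [i]; once the lower coefficients of [g] vanish, the coefficient at [i] is [x_1^i] times that of
    [g]. *)
Lemma homog_fps_low (F : fieldType) (x y : fps F) (g : {poly F}) d n :
    x 0%N = 0 -> x 1%N != 0 -> y 0%N = 1 -> (n < d)%N ->
    (forall i, (i <= n)%N -> homog (@fpsC F) x y d g i = 0) ->
  ('X ^+ n.+1 %| g)%R.
Proof.
move=> x0 x1 y0 lt_nd hom0.
suff g0 i : (i <= n)%N -> g`_i = 0.
  rewrite -(poly_take_drop n.+1 g) dvdp_add ?dvdp_mull //.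
  suff -> : take_poly n.+1 g = 0 by exact: dvdp0.
  by apply/polyP => i; rewrite coef_take_poly coef0 ltnS; case: ifP => // /g0.
elim/ltn_ind: i => i IH le_in.
have := hom0 i le_in; rewrite /homog fps_sum.
rewrite (bigD1 (inord i)) //= big1 => [|j ne_ji].
  rewrite inordK ?ltnS; last by lia.
  rewrite addr0 -mulrA fpsCM (fps_shift x0) exprMn -mulrA fpsXnM ltnn subnn fpsM0 !fpsX0 y0.
  rewrite expr1n mulr1 => /eqP; rewrite mulf_eq0 expf_eq0 (negPf x1) andbF orbF.
  by move/eqP.
have ne_ij : (j : nat) != i.
  by apply: contra ne_ji => /eqP e; apply/eqP/val_inj; rewrite /= inordK -?e.
rewrite -mulrA fpsCM (fps_shift x0) exprMn -mulrA fpsXnM.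
have [lt_ij|le_ji] := ltnP i j; first by rewrite mulr0.
have lt_ji : (j < i)%N by lia.
by rewrite IH ?mul0r //; lia.
Qed.

Definition eqfps (R : Type) M (f g : fps R) := forall i, (i < M)%N -> f i = g i.

Section EqFps.
Variables (R : comNzRingType) (M : nat).
Implicit Types f g h : fps R.
Lemma eqfps_refl f : eqfps M f f. Proof. by []. Qed.
Lemma eqfps_trans f g h : eqfps M f g -> eqfps M g h -> eqfps M f h.
Proof. by move=> h1 h2 i hi; rewrite h1 ?h2. Qed.
Lemma eqfpsD f f' g g' : eqfps M f f' -> eqfps M g g' -> eqfps M (f + g) (f' + g').
Proof. by move=> h1 h2 i hi; rewrite !fpsD h1 ?h2. Qed.
Lemma eqfpsN f f' : eqfps M f f' -> eqfps M (- f) (- f').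
Proof. by move=> h1 i hi; rewrite !fpsN h1. Qed.
Lemma eqfpsM f f' g g' : eqfps M f f' -> eqfps M g g' -> eqfps M (f * g) (f' * g').
Proof.
move=> h1 h2 i hi; rewrite !fpsM; apply: eq_bigr => j _.
by rewrite h1 ?h2 //; have := ltn_ord j; lia.
Qed.
Lemma eqfpsX f f' k : eqfps M f f' -> eqfps M (f ^+ k) (f' ^+ k).
Proof.
move=> h; elim: k => [|k IH]; first exact: eqfps_refl.
by rewrite !exprS; exact: eqfpsM.
Qed.
Lemma eqfps_sum n (f g : 'I_n -> fps R) :
  (forall i, eqfps M (f i) (g i)) -> eqfps M (\sum_i f i) (\sum_i g i).
Proof.
move=> h; elim/big_rec2: _ => [|i w v _ hg]; first exact: eqfps_refl.
exact: eqfpsD.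
Qed.
End EqFps.

(** If [f = 1 + h] with [h] without constant term, then [f^p = 1 + h^p] in characteristic [p]. *)
Lemma fps_frobenius (F : fieldType) (f : fps F) (p : nat) : p \in [pchar F] -> f 0%N = 1 ->
  eqfps p (f ^+ p) 1.
Proof.
move=> pF f0 i lt_ip.
have p_fps : p \in [pchar (fps F)].
  rewrite inE (pcharf_prime pF) /=; apply/eqP; apply: fps_ext => n.
  rewrite fps_nat fps0 natrM (pcharf0 pF) mul0r //.
have f1 : (f - 1) 0%N = 0 by rewrite fpsB f0 fps1 subrr.
have -> : f = 1 + (f - 1) by ring.
rewrite exprDn_pchar ?pnatE ?(pcharf_prime pF) // expr1n fpsD fpsX_low ?addr0 //.
Qed.

Section ModP.
Variable p : nat.
Hypotheses (p_prime : prime p) (p_ge7 : (7 <= p)%N) (p_mod4 : (p %% 4 = 3)%N).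
Local Notation F := 'F_p.

Let p_char : p \in [pchar F]. Proof. exact: pchar_Fp. Qed.

Lemma Fp_nat_neq0 k : (0 < k < p)%N -> k%:R != 0 :> F.
Proof.
move=> /andP[k0 ltkp]; rewrite -(dvdn_pcharf p_char); apply/negP => /dvdn_leq.
by move=> /(_ k0); lia.
Qed.

(* Over an extension containing [i], [(1 + i) ^ p = 1 - i], hence
   [(2 * i) ^ ((p + 1) / 2) = (1 + i) ^ (p + 1) = 2]. *)
Lemma two_power_mod_p (m : nat) : (4 * m = p.+1)%N -> (-1) ^+ m * 2 ^+ (2 * m) = 2 :> F.
Proof.
move=> em.
have [K [io _]] := countable_algebraic_closure F.
have p_K : p \in [pchar K] by rewrite (fmorph_pchar io).
have [i i2] : exists i : K, i ^+ 2 = -1.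
  have [i hi] := @solve_monicpoly K 2 (fun j => if j == 0%N then -1 else 0) isT.
  by exists i; rewrite hi 2!big_ord_recl big_ord0 /= !mulr1 mul0r !addr0.
have ip : (1 + i) ^+ p = 1 - i.
  rewrite exprDn_pchar ?pnatE // expr1n; congr (_ + _).
  (* The form [p = 4 (m - 1) + 3] exhibits [i^p = - i]. *)
  have -> : p = (2 * (2 * m.-1 + 1) + 1)%N by lia.
  rewrite exprD exprM i2 exprD exprM sqrrN !expr1n !expr1 mul1r mulN1r //.
apply: (fmorph_inj io); rewrite rmorphM !rmorphXn rmorphN1 rmorph_nat.
transitivity ((1 + i) ^+ p.+1); last first.
  by rewrite exprS ip mulrC -subr_sqr i2 expr1n opprK.
rewrite -em.
have -> : (4 * m = 2 * (2 * m))%N by lia.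
rewrite [RHS]exprM.
have -> : (1 + i) ^+ 2 = 2 * i by rewrite sqrrD i2; ring.
by rewrite exprMn [i ^+ _]exprM i2 mulrC.
Qed.

Section OctaModP.
Variables (c : nat -> F) (n a b m : nat).
Hypotheses (em : (4 * m = p.+1)%N) (dec : (2 * m = 12 * n + 4 * a + 6 * b)%N)
  (a_lt3 : (a < 3)%N) (b_lt2 : (b < 2)%N).

Let lt_nm : (n < m)%N.
Proof. by lia. Qed.

(** The only case to exclude is [a = 2], [b = 1], in which [p = 24 n + 27] is divisible by [3]. *)
Let lt_ab : (2 * a + 3 * b < 6)%N.
Proof.
have [//|] := ltnP (2 * a + 3 * b) 6; move=> le6.
have [ea eb] : a = 2 /\ b = 1 by lia.
have : (3 %| p)%N by apply/dvdnP; exists (8 * n + 9)%N; lia.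
by rewrite dvdn_prime2 // => /eqP; lia.
Qed.

Lemma octa_mod_p (x : fps F) (th : fps F) :
    x 0%N = 0 -> x 1%N = 16 -> th 0%N = 1 ->
    eqfps n.+1 (octa (@fpsC F) c n a b x (th ^+ 4)) th ->
  forall (S : comNzRingType) (io : {rmorphism F -> S}) (u v : S),
    octa io c n a b u v = u ^+ m + v ^+ m.
Proof.
move=> x0 x1 th0 hx S io u v.
have em' : m = (6 * n + 2 * a + 3 * b)%N by lia.
have m_gt0 : (0 < m)%N by lia.
have F2 : 2 != 0 :> F by apply: Fp_nat_neq0; lia.
have frob (t : {poly F}) :
    (1 - t) ^+ (4 * m) + (1 + t) ^+ (4 * m) = 2 * (t ^+ (4 * m) + 1).
  have p_poly : p \in [pchar {poly F}] by rewrite pchar_poly.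
  rewrite em !exprS !exprDn_pchar ?pnatE // expr1n exprNn.
  have -> : (-1) ^+ p = -1 :> {poly F}.
    by rewrite -signr_odd; have -> : odd p by lia.
  move: (t ^+ p) => w; ring.
(* As [m = 6 n + 2 a + 3 b], the parities of [b] and [m] agree. *)
have scal : (-1) ^+ b * 2 ^+ (12 * n + 4 * a + 6 * b) = 2 :> F.
  rewrite -dec -(signr_odd _ b); have -> : odd b = odd m by lia.
  by rewrite signr_odd; exact: two_power_mod_p.
have th_p : eqfps n.+1 (th ^+ 4 ^+ m) th.
  move=> i lt_in; rewrite -exprM em exprSr.
  have h := @fps_frobenius _ th p p_char th0.
  have lt_ip : (i < p)%N by lia.
  by rewrite (eqfpsM h (@eqfps_refl _ p th)) // mul1r.
have low : ('X ^+ n.+1 %| (octa polyC c n a b 'X 1 - ('X^m + 1) : {poly F}))%R.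
  apply: (@homog_fps_low _ x (th ^+ 4) _ m n) => //.
  - by rewrite x1 (natrX F 2 4) expf_neq0.
  - by rewrite fpsX0 th0 expr1n.
  move=> i le_in; rewrite homog_octa_defect // fpsB fpsD hx // th_p // fpsX_low ?add0r ?subrr //.
  by lia.
have g0 := octa_eq0 em' lt_ab m_gt0 F2 frob scal low.
have := homog_octa_defect c em' io u v; rewrite g0 homog0.
by move/esym/eqP; rewrite subr_eq0 => /eqP.
Qed.

End OctaModP.
End ModP.

(** * Roots over an algebraically closed extension *)

(** The polynomial [X^|F| - X] is the product of [X - a] over [a] in [F], so an element of [K] fixed
    by this power map lies in the image of [F]. *)
Lemma splits_of_roots (F : finFieldType) (K : closedFieldType) (io : {rmorphism F -> K})
    (r : {poly F}) : r != 0 ->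
    (forall z, root (map_poly io r) z -> z ^+ #|F| = z) -> splits r.
Proof.
move=> r0 hr.
have imF (z : K) : z ^+ #|F| = z -> exists x, io x = z.
  move=> hz; have := congr1 (fun g => (map_poly io g).[z]) (finField_genPoly F).
  rewrite rmorphB /= map_polyXn map_polyX hornerD hornerN hornerXn hornerX hz subrr.
  rewrite rmorph_prod horner_prod => /esym/eqP; rewrite prodf_seq_eq0 => /hasP[x _].
  rewrite rmorphB /= map_polyX map_polyC hornerXsubC subr_eq0 => /eqP ->.
  by exists x.
have [zs ezs] := closed_field_poly_normal (map_poly io r).
have l0 : lead_coef (map_poly io r) != 0 by rewrite lead_coef_eq0 map_poly_eq0.
have hz z : z \in zs -> exists x, io x = z.
  move=> zzs; apply/imF/hr; rewrite ezs rootZ // root_prod_XsubC //.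
have {hz} [xs exs] : exists xs, map io xs = zs.
  elim: zs {ezs} hz => [|z zs IH] hz; first by exists [::].
  have [x ex] := hz z (mem_head _ _).
  have [|xs exs] := IH; first by move=> w hw; apply: hz; rewrite inE hw orbT.
  by exists (x :: xs); rewrite /= ex exs.
exists xs; rewrite -(eqp_map io) ezs -exs big_map rmorph_prod.
rewrite (eqp_trans (eqp_scale _ l0)) //.
suff -> : \prod_(j <- xs) ('X - (io j)%:P) = \prod_(i <- xs) map_poly io ('X - i%:P).
  exact: eqpxx.
by apply: eq_bigr => x _; rewrite rmorphB /= map_polyX map_polyC.
Qed.

Section Roots.
Variable p : nat.
Hypotheses (p_prime : prime p) (p_ge7 : (7 <= p)%N).
Local Notation F := 'F_p.
Variables (r : {poly F}) (c : nat -> F) (n a b m : nat).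
Hypotheses (em : (4 * m = p.+1)%N) (size_r : (size r <= n.+1)%N)
  (c_def : forall i, (i <= n)%N -> c i = r`_i * 16^-1 ^+ (n - i)).
Hypothesis octaE : forall (S : comNzRingType) (io : {rmorphism F -> S}) (u v : S),
    octa io c n a b u v = u ^+ m + v ^+ m.

(* For a root [z] of [r] choose [s] with [z = 16 * Q4 s 1 ^ 3 / Q12 s 1], the value
   of [j] at [s]. The octahedral form vanishes at [(s, 1)], so [s ^ m = -1] and
   [s ^ p = s^-1]; as [j] is invariant under [s -> s^-1], [z ^ p = z]. *)
Lemma octa_splits : splits r.
Proof.
have p_char : p \in [pchar F] by exact: pchar_Fp.
have F16 : 16 != 0 :> F by rewrite (natrX F 2 4) expf_neq0 // Fp_nat_neq0 //; lia.
(* At [(0, 1)] the form [Q12] vanishes, so [octaE] retains only the term [i = n]. This makes [r]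
   nonzero. *)
have rn : r`_n = 1.
  have := octaE idfun 0 1; rewrite /octa big_ord_recr big1 => [|i _] /=.
    rewrite add0r subnn expr0 mulr1 c_def // subnn mulr1.
    have -> : Q4 0 1 = 1 :> F by rewrite /Q4; ring.
    have -> : Q6 0 1 = 1 :> F by rewrite /Q6; ring.
    rewrite !expr1n !mulr1.
    by have -> : 0 ^+ m = 0 :> F by [rewrite expr0n; case: eqP => //; lia]; rewrite add0r.
  have -> : Q12 0 1 = 0 :> F by rewrite /Q12 !mul0r.
  by rewrite expr0n subn_eq0 leqNgt ltn_ord mulr0.
have r0 : r != 0 by apply: contra_eq_neq rn => ->; rewrite coef0 eq_sym oner_neq0.
have [K [io _]] := countable_algebraic_closure F.
have p_K : p \in [pchar K] by rewrite (fmorph_pchar io).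
have K16 : 16 != 0 :> K by rewrite -(rmorph_nat io) fmorph_eq0.
apply: (@splits_of_roots _ K io) => // z rz; rewrite card_Fp //.
pose g : {poly K} := 16 *: Q4 'X 1 ^+ 3 - z *: Q12 'X 1.
have [s] : exists s, root g s.
  apply/closed_rootP; suff -> : size g = 7 by [].
  have s4 : size (Q4 'X 1 : {poly K}) = 3.
    have -> : Q4 'X 1 = ('X + 14%:P) * 'X + 1%:P :> {poly K}.
      by rewrite /Q4 polyC1 -polyC_natr; ring.
    by rewrite size_MXaddC size_XaddC oner_eq0 andbF.
  have s43 : size (16 *: Q4 'X 1 ^+ 3 : {poly K}) = 7.
    rewrite size_scale //; have := size_exp (Q4 'X 1 : {poly K}) 3; rewrite s4 /=.
    by case: (size _) => // k /= ->.
  rewrite /g size_polyDl // s43 size_polyN (leq_ltn_trans (size_scale_leq _ _)) //.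
  have -> : Q12 'X 1 = ('X - 1%:P) ^+ 4 * 'X :> {poly K} by rewrite /Q12 polyC1; ring.
  by rewrite size_mulX ?size_exp_XsubC // expf_neq0 // polyXsubC_eq0.
rewrite /root /g.
have -> : (16 *: Q4 'X 1 ^+ 3 - z *: Q12 'X 1).[s] = 16 * Q4 s 1 ^+ 3 - z * Q12 s 1.
  rewrite /Q4 /Q12 -(polyC_natr K 14) !hornerE; ring.
rewrite subr_eq0 => /eqP es.
(* [Q4] and [Q12] have no common zero: [Q4] is [1] at [s = 0] and [16] at [s = 1]. *)
have q12 : Q12 s 1 != 0.
  apply/eqP => q0; move/eqP: es; rewrite q0 mulr0 mulf_eq0 (negPf K16) /= expf_eq0 /=.
  move/eqP: q0; rewrite /Q12 mulr1 mulf_eq0 expf_eq0 /= subr_eq0 => /orP[]/eqP ->.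
    by rewrite /Q4 expr0n !mulr0 mul0r !add0r expr1n oner_eq0.
  have -> : Q4 1 1 = 16 :> K by rewrite /Q4; ring.
  by rewrite (negPf K16).
have sm : s ^+ m = -1.
  apply/eqP; rewrite -subr_eq0 opprK.
  have := octaE io s 1; rewrite expr1n => <-.
  have -> : octa io c n a b s 1 =
      Q4 s 1 ^+ a * Q6 s 1 ^+ b * Q12 s 1 ^+ n * 16 ^- n * (map_poly io r).[z].
    rewrite /octa horner_coef size_map_poly.
    rewrite (big_ord_widen n.+1 (fun i => (map_poly io r)`_i * z ^+ i)) //.
    rewrite [in RHS]big_mkcond mulr_sumr; apply: eq_bigr => i _.
    have le_in : (i <= n)%N by rewrite -ltnS.
    have -> : (if (i < size r)%N then (map_poly io r)`_i * z ^+ i else 0) = io r`_i * z ^+ i.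
      by rewrite coef_map; case: ltnP => // h; rewrite nth_default // rmorph0 mul0r.
    rewrite c_def // rmorphM rmorphXn fmorphV rmorph_nat exprD exprM.
    have -> : Q4 s 1 ^+ 3 = 16^-1 * (z * Q12 s 1) by rewrite -es mulKf.
    have -> : Q12 s 1 ^+ n = Q12 s 1 ^+ i * Q12 s 1 ^+ (n - i) by rewrite -exprD subnKC.
    have -> : 16 ^- n = 16^-1 ^+ i * 16^-1 ^+ (n - i) :> K by rewrite -exprD subnKC // exprVn.
    rewrite !exprMn.
    move: (16^-1 ^+ i) (16^-1 ^+ (n - i)) (z ^+ i) (Q12 s 1 ^+ i) (Q12 s 1 ^+ (n - i)) => A B C D E.
    move: (io _) (Q4 s 1 ^+ a) (Q6 s 1 ^+ b) => *; ring.
  by rewrite (eqP rz) mulr0.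
have s_neq0 : s != 0.
  by apply: contraNneq q12 => ->; rewrite /Q12 !mul0r.
have sp : s * s ^+ p = 1.
  rewrite -exprS -em mulnC exprM sm; ring.
have frobD (x y : K) : (x + y) ^+ p = x ^+ p + y ^+ p by rewrite exprDn_pchar ?pnatE.
have frobN (x : K) : (- x) ^+ p = - x ^+ p.
  by apply/eqP; rewrite -addr_eq0 -frobD addNr expr0n eqn0Ngt prime_gt0.
have frobn k : k%:R ^+ p = k%:R :> K.
  by rewrite -(pFrobenius_autE p_K) rmorph_nat.
(* The [p]-th power of the equation replaces [s] by [s^p = 1 / s] and [z] by [z^p]; the factor [s^6]
   clears the denominators and restores [Q4 s 1] and [Q12 s 1]. *)
have := congr1 (fun x => s ^+ 6 * x ^+ p) es.
rewrite /= [(16 * _) ^+ p]exprMn [(z * _) ^+ p]exprMn frobn.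
have -> : (Q4 s 1 ^+ 3) ^+ p = Q4 (s ^+ p) 1 ^+ 3.
  rewrite exprAC; congr (_ ^+ 3).
  by rewrite /Q4 !mulr1 !expr1n !frobD [(14 * s) ^+ p]exprMn frobn expr1n exprAC.
have -> : Q12 s 1 ^+ p = Q12 (s ^+ p) 1.
  by rewrite /Q12 !mulr1 exprMn exprAC frobD frobN expr1n.
have -> : s ^+ 6 * (16 * Q4 (s ^+ p) 1 ^+ 3) = 16 * Q4 s 1 ^+ 3.
  have -> : s ^+ 6 * (16 * Q4 (s ^+ p) 1 ^+ 3) = 16 * (s ^+ 2 * Q4 (s ^+ p) 1) ^+ 3 by ring.
  congr (_ * _ ^+ 3); rewrite /Q4.
  transitivity ((s * s ^+ p) ^+ 2 + 14 * (s * s ^+ p) * s + s ^+ 2); first by ring.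
  rewrite sp; ring.
have -> : s ^+ 6 * (z ^+ p * Q12 (s ^+ p) 1) = z ^+ p * Q12 s 1.
  rewrite mulrCA; congr (_ * _); rewrite /Q12.
  transitivity (s * (s * s ^+ p) * (s * s ^+ p - s) ^+ 4); first by ring.
  rewrite sp; ring.
by rewrite es => /(mulIf q12).
Qed.

End Roots.

(** * Integrality *)

Lemma fps_triangular_solve (R : comNzRingType) (B : nat -> fps R) (t : fps R) :
    (forall l, B l l = 1) -> (forall l j, (j < l)%N -> B l j = 0) ->
  forall M, exists Q : nat -> R,
    forall j, (j < M)%N -> (\sum_(l < M) fpsC (Q l) * B l) j = t j.
Proof.
move=> Blead Blow; elim=> [|M [Q hQ]]; first by exists (fun=> 0).
pose q := t M - (\sum_(l < M) fpsC (Q l) * B l) M.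
exists (fun l => if l == M then q else Q l) => j le_jM.
rewrite big_ord_recr /= eqxx fpsD fpsCM.
have -> : \sum_(l < M) fpsC (if l == M :> nat then q else Q l) * B l =
    \sum_(l < M) fpsC (Q l) * B l.
  by apply: eq_bigr => l _; rewrite ltn_eqF.
have [lt_jM|] := ltnP j M; first by rewrite Blow // mulr0 addr0 hQ.
move=> le_Mj; have -> : j = M by lia.
by rewrite Blead mulr1 /q addrC subrK.
Qed.

Lemma fps_triangular_unique (R : comNzRingType) (B : nat -> fps R) (Q : nat -> R) M :
    (forall l, B l l = 1) -> (forall l j, (j < l)%N -> B l j = 0) ->
    (forall j, (j < M)%N -> (\sum_(l < M) fpsC (Q l) * B l) j = 0) ->
  forall j, (j < M)%N -> Q j = 0.
Proof.
move=> Blead Blow h; elim/ltn_ind => j IH lt_jM.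
have := h j lt_jM; rewrite fps_sum (bigD1 (Ordinal lt_jM)) //= fpsCM Blead mulr1.
rewrite big1 ?addr0 // => l ne_lj; rewrite fpsCM.
have [lt_jl|le_lj] := ltnP j l; first by rewrite Blow ?mulr0.
rewrite IH ?mul0r //.
have ne : (l : nat) != j by apply: contra ne_lj => /eqP e; apply/eqP/val_inj.
by rewrite ltn_neqAle ne.
Qed.

Lemma sigma1 r : sigma r 1%N = 1.
Proof. by rewrite /sigma /factorizations big_map big_seq1 expr1n. Qed.

(* [5 d^3 + 7 d^5 = 12 d^5 - 5 d * (d^2 (d^2 - 1))], and [d^2 (d^2 - 1) / 12] is the
   iterated sum of squares. *)
Lemma sigma_dvd12 : exists W : fps int,
  [/\ 12 * W = 5 * sigma 3 + 7 * sigma 5, W 0%N = 0 & W 1%N = 1].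
Proof.
pose T d : int := \sum_(i < d) \sum_(j < i.+1) j%:Z ^+ 2.
have hS d : 6 * \sum_(j < d.+1) j%:Z ^+ 2 = d%:Z * (d%:Z + 1) * (2 * d%:Z + 1).
  elim: d => [|d IH]; first by rewrite big_ord1 /=; ring.
  rewrite big_ord_recr /= mulrDr IH; have -> : d.+1%:Z = d%:Z + 1 by lia.
  ring.
have hT d : 12 * T d = d%:Z ^+ 2 * (d%:Z ^+ 2 - 1).
  elim: d => [|d IH]; first by rewrite /T big_ord0; ring.
  rewrite /T big_ord_recr /= mulrDr -/(T d) IH.
  have -> (x : int) : 12 * x = 2 * (6 * x) by ring.
  rewrite hS; have -> : d.+1%:Z = d%:Z + 1 by lia.
  by ring.
pose w d : int := d%:Z ^+ 5 - 5 * d%:Z * T d.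
have hw d : 12 * w d = 5 * d%:Z ^+ 3 + 7 * d%:Z ^+ 5.
  have -> : 12 * w d = 12 * d%:Z ^+ 5 - 5 * d%:Z * (12 * T d) by rewrite /w; ring.
  by rewrite hT; ring.
exists (fun n => \sum_(u <- factorizations n) w u.1); split.
- apply: fps_ext => n; rewrite fpsD !fpsMnatl /sigma !mulr_sumr -big_split.
  by apply: eq_bigr => u _; exact: hw.
- by rewrite big_nil.
- by rewrite /factorizations big_map big_seq1 /w /T !big_ord1 /=; ring.
Qed.

(** In [E4^3 - E6^2] only the linear part [144 (5 sigma 3 + 7 sigma 5)] is not visibly divisible by
    [12^3]; [sigma_dvd12] supplies the missing factor. The other coefficients are [100], [8000] and
    [147] times [12^3]. *)
Lemma discriminant_fps : exists Dl : fps int,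
  [/\ 12 ^+ 3 * Dl = E4 ^+ 3 - E6 ^+ 2, Dl 0%N = 0 & Dl 1%N = 1].
Proof.
have [W [hW W0 W1]] := sigma_dvd12.
have low (h : fps int) k n : h 0%N = 0 -> (n < k)%N -> (h ^+ k) n = 0 by exact: fpsX_low.
have s0 k r : (k%:R * sigma r) 0%N = 0 by rewrite fpsMnatl sigma0 mulr0.
exists (W + (10 * sigma 3) ^+ 2 + (20 * sigma 3) ^+ 3 - 3 * (7 * sigma 5) ^+ 2); split.
- rewrite /E4 /E6; apply: subr0_eq.
  transitivity (12 ^+ 2 * (12 * W - (5 * sigma 3 + 7 * sigma 5))); first by ring.
  exact: lincomb1.
- by rewrite fpsB 2!fpsD fpsMnatl W0 !low // !addr0 mulr0 subr0.
- by rewrite fpsB 2!fpsD fpsMnatl W1 !low // !addr0 mulr0 subr0.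
Qed.

Lemma eisenstein_fps0 : [/\ E2 0%N = 1, E2 1%N = - 24, E4 0%N = 1 & E6 0%N = 1].
Proof.
split; rewrite /E2 /E4 /E6.
- by rewrite fpsB fpsMnatl sigma0 mulr0 subr0.
- by rewrite fpsB fpsMnatl sigma1 mulr1 sub0r.
- by rewrite fpsD fpsMnatl sigma0 mulr0 addr0.
- by rewrite fpsB fpsMnatl sigma0 mulr0 subr0.
Qed.

Lemma theta0 : theta 0%N = 1.
Proof. by rewrite (theta_sum (leqnn 0)) /ints /= big_cons big_nil addr0. Qed.

Lemma theta1 : theta 1%N = 2.
Proof. exact: (@theta_square 1). Qed.

(** The expansion of [j^i] times [Delta^n E4^a E6^b], for [Dl] the expansion of [Delta]. *)
Definition mf_basis (Dl : fps int) n a b i : fps int :=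
  E4 ^+ (3 * i + a) * E6 ^+ b * Dl ^+ (n - i).

Section Integrality.
Variables (Dl : fps int) (n a b : nat).
Hypotheses (Dl0 : Dl 0%N = 0) (Dl1 : Dl 1%N = 1).

(** The basis form of index [n - l] starts with [q^l], so in reversed order the system is
    unitriangular. It has an integral solution, and uniqueness over the rationals identifies that
    solution with [P]. *)
Lemma mf_basis_integral (P : {poly rat}) (t : fps int) : (size P <= n.+1)%N ->
    (forall j, (j <= n)%N ->
      (\sum_(i < n.+1) fpsC P`_i * map_fps intr (mf_basis Dl n a b i)) j = (t j)%:~R) ->
  exists Q : {poly int}, P = map_poly intr Q /\
    forall j, (j <= n)%N -> (\sum_(i < n.+1) fpsC Q`_i * mf_basis Dl n a b i) j = t j.
Proof.
move=> sP hP.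
pose B l := E4 ^+ (3 * (n - l) + a) * E6 ^+ b * Dl ^+ l.
have BE l : (l <= n)%N -> B l = mf_basis Dl n a b (n - l).
  by move=> h; rewrite /B /mf_basis subKn.
have Blow l j : (j < l)%N -> B l j = 0.
  by move=> h; rewrite /B mulrC; apply: fpsM_low h => i; exact: fpsX_low.
have Blead l : B l l = 1.
  have [_ _ e40 e60] := eisenstein_fps0.
  rewrite /B (fps_shift Dl0) exprMn mulrCA fpsXnM ltnn subnn.
  by rewrite !fpsM0 !fpsX0 e40 e60 Dl1 !expr1n !mulr1.
have [Q hQ] := fps_triangular_solve t Blead Blow n.+1.
pose q i := Q (n - i)%N.
have hq j : (j <= n)%N -> (\sum_(i < n.+1) fpsC (q i) * mf_basis Dl n a b i) j = t j.
  move=> le_jn; rewrite -hQ ?ltnS // (reindex_inj rev_ord_inj) /=.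
  apply: (congr1 (fun f : fps int => f j)); apply: eq_bigr => l _.
  have le_ln : (l <= n)%N by rewrite -ltnS.
  by rewrite /q subSS subKn // BE.
have Pq i : (i <= n)%N -> P`_i = (q i)%:~R.
  move=> le_in; apply/eqP; rewrite -subr_eq0; apply/eqP.
  pose Br l : fps rat := map_fps intr (B l).
  have Br_lead l : Br l l = 1 by rewrite /Br /map_fps Blead.
  have Br_low l j : (j < l)%N -> Br l j = 0 by move=> h; rewrite /Br /map_fps Blow.
  suff h0 j : (j < n.+1)%N -> (\sum_(l < n.+1)
      fpsC (P`_(n - l) - (q (n - l)%N)%:~R) * Br l) j = 0.
    have := @fps_triangular_unique _ Br (fun l => P`_(n - l) - (q (n - l)%N)%:~R)
      n.+1 Br_lead Br_low h0 (n - i)%N.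
    by rewrite subKn // => -> //; rewrite ltnS leq_subr.
  move=> le_jn.
  have : (\sum_(i < n.+1) fpsC (P`_i - (q i)%:~R) * map_fps intr (mf_basis Dl n a b i)) j = 0.
    under eq_bigr do rewrite rmorphB mulrBl.
    rewrite sumrB fpsB hP // -hq // fps_sum fps_sum rmorph_sum -sumrB big1 // => l _.
    by rewrite !fpsCM /map_fps rmorphM subrr.
  rewrite (reindex_inj rev_ord_inj) /= => h0; rewrite -[RHS]h0.
  apply: (congr1 (fun f : fps rat => f j)); apply: eq_bigr => l _.
  have le_ln : (l <= n)%N by rewrite -ltnS.
  by rewrite subSS /Br BE.
exists (\poly_(i < n.+1) q i); split.
  apply/polyP => i; rewrite coef_map coef_poly; case: ltnP => [lt_in|le_ni].
    exact: Pq.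
  by rewrite nth_default // (leq_trans sP).
move=> j le_jn; rewrite -hq //; apply: (congr1 (fun f : fps int => f j)); apply: eq_bigr => i _.
by rewrite coef_poly ltn_ord.
Qed.

End Integrality.

Lemma splits_mod_p (p n a b m : nat) (Dl : fps int) (Q : {poly int}) :
    prime p -> (7 <= p)%N -> (p %% 4 = 3)%N -> (4 * m = p.+1)%N ->
    (2 * m = 12 * n + 4 * a + 6 * b)%N -> (a < 3)%N -> (b < 2)%N ->
    12 ^+ 3 * Dl = E4 ^+ 3 - E6 ^+ 2 -> (size Q <= n.+1)%N ->
    (forall j, (j <= n)%N -> (\sum_(i < n.+1) fpsC Q`_i * mf_basis Dl n a b i) j = theta j) ->
  splits (map_poly intr Q : {poly 'F_p}).
Proof.
move=> p_prime p_ge7 p_mod4 em dec a_lt3 b_lt2 disc sQ hQ.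
have nz := Fp_nat_neq0 p_prime.
have F2 : 2 != 0 :> 'F_p by apply: nz; lia.
have F3 : 3 != 0 :> 'F_p by apply: nz; lia.
have F5 : 5 != 0 :> 'F_p by apply: nz; lia.
pose io : {rmorphism int -> 'F_p} := intr.
pose red := map_fps io.
have redn k : red k%:R = k%:R by exact: rmorph_nat.
have [e2_0 e2_1 e4_0 e6_0] := eisenstein_fps0.
have r2 : 12 * fpsD1 (red E2) = red E2 ^+ 2 - red E4.
  by rewrite -map_fpsD1 -redn -rmorphM ramanujan2 rmorphB rmorphXn.
have r4 : 3 * fpsD1 (red E4) = red E2 * red E4 - red E6.
  by rewrite -map_fpsD1 -redn -rmorphM ramanujan4 rmorphB rmorphM.
have r6 : 2 * fpsD1 (red E6) = red E2 * red E6 - red E4 ^+ 2.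
  by rewrite -map_fpsD1 -redn -rmorphM ramanujan6 rmorphB rmorphM rmorphXn.
have ode : 16 * fpsD1 (fpsD1 (red theta)) =
    4 * (red E2 * fpsD1 (red theta)) - fpsD1 (red E2) * red theta.
  rewrite -!map_fpsD1 -[16]redn -[4]redn -!rmorphM theta_ode rmorphB !rmorphM //.
(* Both [N] and [4 N - 1] are positive and less than [4 m - 1 = p]. *)
have Fm N : (0 < N < m)%N -> N%:R != 0 :> 'F_p /\ 4 * N%:R - 1 != 0 :> 'F_p.
  move=> hN; split; first by apply: nz; lia.
  have -> : 4 * N%:R - 1 = (4 * N - 1)%:R :> 'F_p by rewrite natrB ?natrM //; lia.
  by apply: nz; lia.
have red0 (f : fps int) j z : f j = z -> red f j = z%:~R by move=> <-.
have [x [x0 x1 hx4 hx6]] := @theta_parametrization _ (red E2) (red E4) (red E6) (red theta) m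
  r2 r4 r6 ode (red0 _ _ _ e2_0) (red0 _ _ _ e2_1) (red0 _ _ _ e4_0) (red0 _ _ _ e6_0)
  (red0 _ _ _ theta0) (red0 _ _ _ theta1) F2 F3 F5 Fm.
have lt_nm : (n < m)%N by lia.
pose r : {poly 'F_p} := map_poly io Q.
(* The powers of [16] compensate for [Q12] being [16 Delta]. *)
pose c i : 'F_p := r`_i * 16^-1 ^+ (n - i).
have F16 : 16 != 0 :> 'F_p by rewrite (natrX _ 2 4) expf_neq0.
have h4 : eqfps n.+1 (Q4 x (red theta ^+ 4)) (red E4).
  by move=> i hi; rewrite hx4 //; lia.
have h6 : eqfps n.+1 (Q6 x (red theta ^+ 4)) (red E6).
  by move=> i hi; rewrite hx6 //; lia.
have h12 : eqfps n.+1 (Q12 x (red theta ^+ 4)) (16 * red Dl).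
  move=> i hi.
  have F108 : 108 != 0 :> 'F_p.
    by rewrite (natrM _ 4 27) (natrX _ 2 2) (natrX _ 3 3) mulf_neq0 // expf_neq0.
  apply: (mulfI F108); rewrite -!fpsMnatl -Q4_Q6.
  have -> : 108 * (16 * red Dl) = red E4 ^+ 3 - red E6 ^+ 2.
    have -> : red E4 ^+ 3 - red E6 ^+ 2 = 12 ^+ 3 * red Dl.
      have := congr1 red disc; rewrite [LHS]rmorphM [in LHS]rmorphXn [RHS]rmorphB.
      by rewrite !rmorphXn -(redn 12) => ->.
    by rewrite mulrA -natrM -natrX.
  by apply: (eqfpsD (eqfpsX 3 h4) (eqfpsN (eqfpsX 2 h6))).
have hocta : eqfps n.+1 (octa (@fpsC _) c n a b x (red theta ^+ 4)) (red theta).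
  apply: (@eqfps_trans _ _ _ (\sum_(i < n.+1) fpsC r`_i * red (mf_basis Dl n a b i))).
    apply: eqfps_sum => i.
    have -> : fpsC r`_i * red (mf_basis Dl n a b i) =
        fpsC (c i) * red E4 ^+ (3 * i + a) * red E6 ^+ b * (16 * red Dl) ^+ (n - i).
      have k16 : fpsC 16^-1 * 16 = 1 :> fps 'F_p.
        by rewrite -[16 in X in _ * X](rmorph_nat (@fpsC 'F_p)) -rmorphM mulVf // rmorph1.
      have kd : fpsC 16^-1 ^+ (n - i) * 16 ^+ (n - i) = 1 :> fps 'F_p.
        by rewrite -exprMn k16 expr1n.
      have -> : fpsC (c i) = fpsC r`_i * fpsC 16^-1 ^+ (n - i) by rewrite rmorphM rmorphXn.
      have -> : red (mf_basis Dl n a b i) =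
          red E4 ^+ (3 * i + a) * red E6 ^+ b * red Dl ^+ (n - i).
        by rewrite /mf_basis /red !rmorphM !rmorphXn.
      rewrite [(16 * _) ^+ _]exprMn.
      move: (fpsC 16^-1 ^+ _) (16 ^+ _) kd => K L kd.
      move: (fpsC _) (red E4 ^+ _) (red E6 ^+ _) (red Dl ^+ _) => U V W Z.
      transitivity (U * (V * W * Z) * (K * L)); first by rewrite kd mulr1.
      by ring.
    apply: eqfpsM (eqfpsX _ h12); apply: eqfpsM (eqfpsX _ h6).
    by apply: eqfpsM (eqfpsX _ h4); exact: eqfps_refl.
  move=> j; rewrite ltnS => le_jn; rewrite -[RHS]/(io (theta j)) -hQ //.
  rewrite !fps_sum rmorph_sum.
  by apply: eq_bigr => i _; rewrite !fpsCM rmorphM coef_map.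
have octaE := octa_mod_p p_prime p_ge7 p_mod4 em dec a_lt3 b_lt2 x0 x1
  (red0 _ _ _ theta0) hocta.
apply: (octa_splits p_prime p_ge7 em _ _ octaE); last by [].
by rewrite (leq_trans (size_poly _ _)).
Qed.

Import numFieldNormedType.Exports.
Local Open Scope classical_set_scope.
Local Open Scope complex_scope.

(** * Expansions at q = 0 *)
Section Asymptotic.
Variable R : realType.
Implicit Types (phi psi : R -> R) (a b : fps R).

(** An asymptotic expansion as [q] tends to [0] from above. Such expansions are closed under sums
    and products and determine their coefficients, so identities between functions pass to formal
    series. *)
Definition asymp phi a := forall M, exists C e : R, 0 < e /\
  forall q, 0 < q < e -> `|phi q - \sum_(i < M) a i * q ^+ i| <= C * q ^+ M.

Lemma asymp_ext phi psi a (e : R) : 0 < e -> (forall q, 0 < q < e -> phi q = psi q) ->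
  asymp phi a -> asymp psi a.
Proof.
move=> e0 h H M; have [C [d [d0 hd]]] := H M.
exists C, (Num.min d e); split; first by rewrite lt_min d0.
move=> q /andP[q0]; rewrite lt_min => /andP[qd qe].
by rewrite -h ?q0 //; apply: hd; rewrite q0.
Qed.

Lemma poly_bounded (p : {poly R}) : exists2 C : R, 0 <= C & forall q, 0 < q < 1 -> `|p.[q]| <= C.
Proof.
exists (\sum_(i < size p) `|p`_i|); first by apply: sumr_ge0.
move=> q /andP[q0 q1]; rewrite horner_coef.
apply: (le_trans (ler_norm_sum _ _ _)); apply: ler_sum => i _.
rewrite normrM [`|q ^+ i|]ger0_norm ?exprn_ge0 ?(ltW q0) //.
by rewrite ler_piMr // exprn_ile1 // ltW.
Qed.

Lemma asymp_cst c : asymp (fun=> c) (fpsC c).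
Proof.
move=> M; exists `|c|, 1; split=> // q /andP[q0 q1]; case: M => [|M].
  by rewrite big_ord0 subr0 mulr1.
rewrite big_ord_recl big1 => [|i _]; last by rewrite /fpsC mul0r.
by rewrite addr0 mulr1 subrr normr0 mulr_ge0 // exprn_ge0 // ltW.
Qed.

Lemma asympD phi psi a b : asymp phi a -> asymp psi b ->
  asymp (fun q => phi q + psi q) (a + b).
Proof.
move=> ha hb M; have [C [e [e0 h1]]] := ha M; have [D [d [d0 h2]]] := hb M.
exists (C + D), (Num.min e d); split; first by rewrite lt_min e0.
move=> q /andP[q0]; rewrite lt_min => /andP[qe qd].
have -> : phi q + psi q - \sum_(i < M) (a + b) i * q ^+ i =
    (phi q - \sum_(i < M) a i * q ^+ i) + (psi q - \sum_(i < M) b i * q ^+ i).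
  under eq_bigr do rewrite fpsD mulrDl.
  by rewrite big_split /=; ring.
rewrite mulrDl; apply: (le_trans (ler_normD _ _)); apply: lerD.
  by apply: h1; rewrite q0.
by apply: h2; rewrite q0.
Qed.

Lemma asympM phi psi a b : asymp phi a -> asymp psi b ->
  asymp (fun q => phi q * psi q) (a * b).
Proof.
move=> ha hb M; have [C [e [e0 h1]]] := ha M; have [D [d [d0 h2]]] := hb M.
pose pa : {poly R} := \poly_(i < M) a i; pose pb : {poly R} := \poly_(i < M) b i.
have [A A0 hA] := poly_bounded pa; have [B B0 hB] := poly_bounded pb.
have [T T0 hT] := poly_bounded (drop_poly M (pa * pb)).
have paE q : \sum_(i < M) a i * q ^+ i = pa.[q] by rewrite horner_poly.
have pbE q : \sum_(i < M) b i * q ^+ i = pb.[q] by rewrite horner_poly.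
have abE q : \sum_(i < M) (a * b) i * q ^+ i = (take_poly M (pa * pb)).[q].
  rewrite horner_poly; apply: eq_bigr => i _; congr (_ * _).
  rewrite fpsM coefM; apply: eq_bigr => j _.
  rewrite !coef_poly; have := ltn_ord i; have := ltn_ord j => hj hi.
  by rewrite !ifT //; lia.
exists (`|C| * (B + `|D|) + A * `|D| + T), (Num.min 1 (Num.min e d)); split.
  by rewrite !lt_min ltr01 e0.
move=> q /andP[q0]; rewrite !lt_min => /and3P[q1 qe qd].
have {h1} h1 : `|phi q - pa.[q]| <= `|C| * q ^+ M.
  rewrite -paE; apply: (le_trans (h1 q _)); first by rewrite q0.
  by rewrite ler_wpM2r ?ler_norm // exprn_ge0 // ltW.
have {h2} h2 : `|psi q - pb.[q]| <= `|D| * q ^+ M.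
  rewrite -pbE; apply: (le_trans (h2 q _)); first by rewrite q0.
  by rewrite ler_wpM2r ?ler_norm // exprn_ge0 // ltW.
have q01 : 0 < q < 1 by rewrite q0.
have qM : 0 <= q ^+ M <= 1 by rewrite exprn_ge0 ?exprn_ile1 ?ltW.
have hpsi : `|psi q| <= B + `|D|.
  have -> : psi q = pb.[q] + (psi q - pb.[q]) by ring.
  apply: (le_trans (ler_normD _ _)); apply: lerD; first exact: hB.
  by apply: (le_trans h2); rewrite ler_piMr //; case/andP: qM.
have pq : pa.[q] * pb.[q] = (take_poly M (pa * pb)).[q] + (drop_poly M (pa * pb)).[q] * q ^+ M.
  by rewrite -hornerM -{1}(poly_take_drop M (pa * pb)) hornerD hornerM hornerXn.
(* The error splits into that of [phi], that of [psi], and the part of degree at least [M] of the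
   product of the two truncations. *)
have -> : phi q * psi q - \sum_(i < M) (a * b) i * q ^+ i =
   (phi q - pa.[q]) * psi q + pa.[q] * (psi q - pb.[q]) + (drop_poly M (pa * pb)).[q] * q ^+ M.
  rewrite abE; move: pq; move: (take_poly _ _).[q] (_ * q ^+ M) => x y e1.
  have -> : x = pa.[q] * pb.[q] - y by rewrite e1; ring.
  by ring.
rewrite [leRHS]mulrDl [in leRHS]mulrDl; apply: (le_trans (ler_normD _ _)); apply: lerD.
  apply: (le_trans (ler_normD _ _)); apply: lerD; rewrite normrM.
    by rewrite mulrAC ler_pM.
  by rewrite -mulrA ler_pM // hA.
have [qM0 _] := andP qM.
by rewrite normrM [`|q ^+ M|]ger0_norm // ler_wpM2r ?hT.
Qed.

Lemma asympX phi a k : asymp phi a -> asymp (fun q => phi q ^+ k) (a ^+ k).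
Proof.
move=> h; elim: k => [|k IH].
  by have := asymp_cst 1; rewrite rmorph1.
by rewrite exprS; apply: (@asymp_ext (fun q => phi q * phi q ^+ k) _ _ 1) => // ;
  [move=> q _; rewrite exprS | exact: asympM].
Qed.

Lemma asymp_sum n (F : 'I_n -> R -> R) (A : 'I_n -> fps R) :
  (forall i, asymp (F i) (A i)) -> asymp (fun q => \sum_i F i q) (\sum_i A i).
Proof.
elim: n F A => [|n IH] F A h.
  rewrite big_ord0 -(rmorph0 (@fpsC R)).
  by apply: (asymp_ext ltr01 _ (asymp_cst 0)) => q _; rewrite big_ord0.
have hn := IH _ _ (fun i => h (widen_ord (leqnSn n) i)).
rewrite big_ord_recr; apply: (asymp_ext ltr01 _ (asympD hn (h ord_max))).
by move=> q _; rewrite big_ord_recr.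
Qed.

Lemma asymp_unique phi a b : asymp phi a -> asymp phi b -> a = b.
Proof.
move=> ha hb; apply: fps_ext; elim/ltn_ind => n IH.
have [C [e [e0 h1]]] := ha n.+1; have [D [d [d0 h2]]] := hb n.+1.
apply/eqP; rewrite -subr_eq0 -normr_le0; apply/ler_addgt0Pr => eps eps0.
rewrite add0r.
pose K := `|C| + `|D| + 1.
have K0 : 0 < K by rewrite ltr_wpDl // addr_ge0.
pose q := Num.min (Num.min e d) (eps / K) / 2.
(* The two expansions give [|a n - b n| q^n <= K q^(n+1)], and [q] is taken so small that
   [K q < eps]. *)
have m0 : 0 < Num.min (Num.min e d) (eps / K) by rewrite !lt_min e0 d0 divr_gt0.
have q0 : 0 < q by rewrite divr_gt0.
have : q < Num.min (Num.min e d) (eps / K).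
  by rewrite ltr_pdivrMr // ltr_pMr // ltr1n.
rewrite !lt_min => /andP[/andP[qe qd] qk].
have {}h1 := h1 q; have {}h2 := h2 q.
rewrite q0 qe in h1; rewrite q0 qd in h2.
have {h1}h1 := h1 isT; have {h2}h2 := h2 isT.
rewrite !big_ord_recr /= in h1 h2.
have eS : \sum_(i < n) a i * q ^+ i = \sum_(i < n) b i * q ^+ i.
  by apply: eq_bigr => i _; rewrite IH.
have h : `|a n - b n| * q ^+ n <= K * q * q ^+ n.
  have -> : `|a n - b n| * q ^+ n =
     `|(phi q - (\sum_(i < n) b i * q ^+ i + b n * q ^+ n)) -
       (phi q - (\sum_(i < n) a i * q ^+ i + a n * q ^+ n))|.
    rewrite -[q ^+ n in LHS]ger0_norm ?exprn_ge0 ?(ltW q0) // -normrM eS.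
    by congr `|_|; ring.
  apply: (le_trans (ler_normB _ _)).
  apply: (le_trans (lerD h2 h1)).
  have qq0 : 0 <= q * q ^+ n by rewrite -exprS exprn_ge0 // ltW.
  rewrite -mulrDl exprS -mulrA ler_wpM2r //.
  by rewrite /K; have := ler_norm C; have := ler_norm D; lra.
rewrite ler_pM2r ?exprn_gt0 // in h.
apply: (le_trans h); rewrite -ler_pdivlMl // mulrC; exact: ltW.
Qed.

End Asymptotic.

(** Convergence at [q0 = e / 2] bounds the terms there by [C]; for [q < q0 / 2] the tail from [M] on
    is dominated by [C (q / q0)^M] times the geometric series of ratio [1 / 2]. *)
Lemma asymp_series (R : realType) (a : fps R) (phi : R -> R) (e : R) : 0 < e ->
    (forall q, 0 < q < e -> series (fun n => a n * q ^+ n) @ \oo --> phi q) ->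
  asymp phi a.
Proof.
move=> e0 h M.
pose q0 := e / 2.
have q0_gt0 : 0 < q0 by rewrite divr_gt0.
have q0_lt : q0 < e by rewrite ltr_pdivrMr // ltr_pMr // ltr1n.
have cvg0 : cvgn (series (fun n => a n * q0 ^+ n)).
  by apply/cvg_ex; exists (phi q0); apply: h; rewrite q0_gt0.
have [C hC] : exists C, forall n, `|a n * q0 ^+ n| <= C.
  have := cvg_seq_bounded (cvgP _ (cvg_series_cvg_0 cvg0)).
  move=> [C [_ hC]]; exists (C + 1) => n; apply: hC => //; by rewrite ltrDl.
have C0 : 0 <= C by apply: le_trans (hC 0%N).
exists (C * q0^-1 ^+ M * 2), (q0 / 2); split; first by rewrite divr_gt0.
move=> q /andP[q_gt0 q_lt].
have q_e : q < e.
  by move: q_lt; rewrite /q0; lra.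
pose w := q / q0.
have w0 : 0 < w by rewrite divr_gt0.
have w2 : w <= 2^-1 by rewrite /w ler_pdivrMr // mulrC ltW.
have part k : `|series (fun n => a n * q ^+ n) (M + k)%N - \sum_(i < M) a i * q ^+ i| <=
    C * w ^+ M * (2 - 2 * 2^-1 ^+ k).
  elim: k => [|k IH].
    by rewrite addn0 /series /= big_mkord subrr normr0 expr0 mulr1 subrr mulr0.
  rewrite addnS seriesSr /=.
  set S := series _ _ in IH *; set T := \sum_(i < M) _ in IH *.
  have -> : S + a (M + k)%N * q ^+ (M + k) - T = (S - T) + a (M + k)%N * q ^+ (M + k) by ring.
  have -> : C * w ^+ M * (2 - 2 * 2^-1 ^+ k.+1) =
      C * w ^+ M * (2 - 2 * 2^-1 ^+ k) + C * w ^+ M * 2^-1 ^+ k.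
    by rewrite exprS; field.
  apply: (le_trans (ler_normD _ _)); apply: lerD => //.
  have -> : a (M + k)%N * q ^+ (M + k) = (a (M + k)%N * q0 ^+ (M + k)) * (w ^+ M * w ^+ k).
    rewrite -exprD -mulrA -exprMn /w; congr (_ * _ ^+ _).
    by rewrite mulrCA divff ?mulr1 // gt_eqF.
  rewrite normrM -mulrA; apply: ler_pM => //.
  rewrite ger0_norm ?mulr_ge0 ?exprn_ge0 ?(ltW w0) //.
  by rewrite ler_wpM2l ?exprn_ge0 ?(ltW w0) // lerXn2r // nnegrE ltW // invr_gt0.
have hq : series (fun n => a n * q ^+ n) @ \oo --> phi q by apply: h; rewrite q_gt0.
have -> : C * q0^-1 ^+ M * 2 * q ^+ M = C * w ^+ M * 2.
  by rewrite /w exprMn; ring.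
have hn : `|series (fun n => a n * q ^+ n) N - \sum_(i < M) a i * q ^+ i| @[N --> \oo] -->
    `|phi q - \sum_(i < M) a i * q ^+ i|.
  by apply: cvg_norm; apply: cvgB; [exact: hq | exact: cvg_cst].
apply: (cvgr_to_le hn).
exists M => // N /= le_MN.
have -> : N = (M + (N - M))%N by rewrite subnKC.
apply: (le_trans (part _)); rewrite ler_wpM2l ?mulr_ge0 ?exprn_ge0 ?(ltW w0) //.
by rewrite lerBlDr lerDl mulr_ge0 // exprn_ge0 // invr_ge0.
Qed.

(** * Bernoulli numbers and Eisenstein coefficients *)

Lemma bernoulli_seqS m : bernoulli_seq m.+1 =
  rcons (bernoulli_seq m) (- (\sum_(j < m.+1) 'C(m.+2, j)%:R * (bernoulli_seq m)`_j) / m.+2%:R).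
Proof. by []. Qed.

Lemma bernoulli_seq4 : bernoulli_seq 4 = [:: 1; -1/2; 1/6; 0; -1/30].
Proof.
have e0 : bernoulli_seq 0 = [:: 1] by [].
have e1 : bernoulli_seq 1 = [:: 1; -1/2].
  rewrite bernoulli_seqS e0 !big_ord_recl big_ord0 /=; congr [:: _; _]; field.
have e2 : bernoulli_seq 2 = [:: 1; -1/2; 1/6].
  rewrite bernoulli_seqS e1 !big_ord_recl big_ord0 /=; congr [:: _; _; _]; field.
have e3 : bernoulli_seq 3 = [:: 1; -1/2; 1/6; 0].
  rewrite bernoulli_seqS e2 !big_ord_recl big_ord0 /=; congr [:: _; _; _; _]; field.
rewrite bernoulli_seqS e3 !big_ord_recl big_ord0 /=; congr [:: _; _; _; _; _]; field.
Qed.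

Lemma bernoulli_seq6 : bernoulli_seq 6 = [:: 1; -1/2; 1/6; 0; -1/30; 0; 1/42].
Proof.
have e5 : bernoulli_seq 5 = [:: 1; -1/2; 1/6; 0; -1/30; 0].
  rewrite bernoulli_seqS bernoulli_seq4 !big_ord_recl big_ord0 /=; congr [:: _; _; _; _; _; _]; field.
rewrite bernoulli_seqS e5 !big_ord_recl big_ord0 /=; congr [:: _; _; _; _; _; _; _]; field.
Qed.

Lemma bernoulli4 : bernoulli 4 = -1/30.
Proof. by rewrite /bernoulli bernoulli_seq4. Qed.

Lemma bernoulli6 : bernoulli 6 = 1/42.
Proof. by rewrite /bernoulli bernoulli_seq6. Qed.

Lemma eisenstein_coef4 n : eisenstein_coef 4 n = (E4 n)%:~R.
Proof.
rewrite /eisenstein_coef /E4 fpsD fpsMnatl; case: eqP => [->|n0].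
  by rewrite sigma0 mulr0 addr0.
rewrite bernoulli4 fps1 sigmaE ?lt0n; last exact/eqP.
have -> : (n == 0)%N = false by apply/eqP.
rewrite add0r rmorphM rmorph_nat /=; congr (_ * _).
Qed.

Lemma eisenstein_coef6 n : eisenstein_coef 6 n = (E6 n)%:~R.
Proof.
rewrite /eisenstein_coef /E6 fpsB fpsMnatl; case: eqP => [->|n0].
  by rewrite sigma0 mulr0 subr0.
rewrite bernoulli6 fps1 sigmaE ?lt0n; last exact/eqP.
have -> : (n == 0)%N = false by apply/eqP.
rewrite sub0r rmorphN rmorphM rmorph_nat mulNr /=; congr (- (_ * _)).
Qed.

(** * Eisenstein series on the positive imaginary axis *)

Section Nome.
Variable R : realType.

(** The inverse of the nome on the imaginary axis. *)
Definition tau_of (q : R) : R[i] := 0 +i* (- ln q / (2 * pi)).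

Lemma upper_tau_of (q : R) : 0 < q < 1 -> upper_half_plane (tau_of q).
Proof.
move=> /andP[q0 q1]; rewrite /upper_half_plane /= divr_gt0 ?mulr_gt0 ?pi_gt0 //.
by rewrite oppr_gt0 ln_lt0 // q0.
Qed.

Lemma nome_tau_of (q : R) : 0 < q -> nome (tau_of q) = q%:C.
Proof.
move=> q0; rewrite /nome.
set t : R := - ln q / (2 * pi).
have -> : 2 * (pi : R)%:C * 'i%C * tau_of q = (ln q)%:C.
  have -> : tau_of q = 'i%C * t%:C.
    by apply/eqP; rewrite eq_complex /tau_of /=; apply/andP; split; apply/eqP; rewrite -/t; ring.
  transitivity ('i%C ^+ 2 * (2 * pi * t)%:C); first by rewrite !rmorphM rmorph_nat /=; ring.
  rewrite sqr_i mulN1r -rmorphN /=; congr _%:C; rewrite /t.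
  have pi0 : (pi : R) != 0 by rewrite gt_eqF ?pi_gt0.
  by move: (pi : R) pi0 => c c0; field.
rewrite /cexp /= cos0 sin0 lnK ?posrE //.
by rewrite -[X in _ * X]/(1%:C) mulr1.
Qed.

Lemma real_complex_cvg (u : nat -> R) (l : R) :
  u @ \oo --> l -> (fun n => (u n)%:C) @ \oo --> l%:C.
Proof.
move=> /cvgrPdist_lt h; apply/cvgrPdist_lt => e.
rewrite ltcE /= => /andP[/eqP e0 e_gt0].
have := h _ e_gt0; apply: filterS => n hn.
by rewrite -rmorphB normc_def /= expr0n addr0 sqrtr_sqr ltcE /= e0 eqxx.
Qed.

Lemma Re_cvg (u : nat -> R[i]) (l : R[i]) :
  u @ \oo --> l -> (fun n => complex.Re (u n)) @ \oo --> complex.Re l.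
Proof.
move=> /cvgrPdist_lt h; apply/cvgrPdist_lt => e e0.
have eC : 0 < e%:C :> R[i] by rewrite ltcR.
have := h _ eC; apply: filterS => n hn.
rewrite -ltcR; apply: le_lt_trans hn.
by have := normc_ge_Re (l - u n); rewrite raddfB.
Qed.

(** From [sigma_r (n) <= n^(r+1)] and [n < 2^n]. The bound is crude, but convergence near [q = 0] is
    enough. *)
Lemma sigma_bound r n : `|(sigma r n)%:~R : R| <= (2 ^ r.+1)%:R ^+ n.
Proof.
case: n => [|n]; first by rewrite sigma0 normr0.
rewrite sigmaE // -pmulrn normr_nat -natrX ler_nat.
have le_size : (size (divisors n.+1) <= n.+1)%N.
  rewrite -[leqRHS](size_iota 1); apply: uniq_leq_size; first exact: divisors_uniq.
  move=> d; rewrite -dvdn_divisors // mem_iota => hd.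
  by rewrite add1n ltnS (dvdn_leq _ hd) // andbT (dvdn_gt0 _ hd).
apply: (@leq_trans (\sum_(d <- divisors n.+1) n.+1 ^ r)).
  rewrite big_seq [leqRHS]big_seq; apply: leq_sum => d; rewrite -dvdn_divisors // => hd.
  by case: (r) => // s; rewrite leq_exp2r // dvdn_leq.
rewrite big_const_seq count_predT iter_addn_0.
apply: (@leq_trans (n.+1 ^ r * n.+1)); first by rewrite leq_mul2l le_size orbT.
by rewrite -expnSr -expnM mulnC expnM leq_exp2r // ltnW // ltn_expl.
Qed.

Lemma qseries_cvg (a : fps R) (K : R) r : (forall n, `|a n| <= K * (2 ^ r)%:R ^+ n) ->
  forall q, 0 < q < (2 ^ r.+1)%:R^-1 -> cvgn (series (fun n => a n * q ^+ n)).
Proof.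
move=> ha q /andP[q0 q1].
have K0 : 0 <= K by have := ha 0%N; rewrite expr0 mulr1; apply: le_trans.
apply: normed_cvg; apply: (@series_le_cvg _ _ (geometric K 2^-1)).
- by move=> n /=.
- by move=> n /=; rewrite mulr_ge0 // exprn_ge0 // invr_ge0.
- move=> n /=; rewrite normrM [`|q ^+ n|]ger0_norm ?exprn_ge0 ?(ltW q0) //.
  apply: (le_trans (ler_wpM2r _ (ha n))); first by rewrite exprn_ge0 // ltW.
  rewrite -mulrA -exprMn ler_wpM2l // lerXn2r ?nnegrE ?mulr_ge0 ?(ltW q0) ?invr_ge0 //.
  have p0 : 0 < (2 ^ r)%:R :> R by rewrite ltr0n expn_gt0.
  rewrite mulrC -ler_pdivlMr // -invfM -natrM -expnS; exact: ltW.
- by apply: is_cvg_geometric_series; rewrite ger0_norm ?invr_ge0 // invf_lt1 // ltr1n.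
Qed.

End Nome.

(** Close to [0] the leading term dominates. This keeps the denominator in [is_Pf] nonzero. *)
Lemma asymp_neq0 (R : realType) (phi : R -> R) (a : fps R) d : asymp phi a ->
    (forall i, (i < d)%N -> a i = 0) -> a d != 0 ->
  exists2 e : R, 0 < e & forall q, 0 < q < e -> phi q != 0.
Proof.
move=> h low ad; have [C [e [e0 he]]] := h d.+1.
have K0 : 0 < `|C| + 1 by rewrite ltr_wpDl.
have d0 : 0 < `|a d| by rewrite normr_gt0.
exists (Num.min e (`|a d| / (`|C| + 1))); first by rewrite lt_min e0 divr_gt0.
move=> q /andP[q0]; rewrite lt_min => /andP[qe qd]; apply/eqP => phi0.
have := he q; rewrite q0 qe => /(_ isT).
rewrite phi0 big_ord_recr big1 /= => [|i _]; last by rewrite low ?mul0r.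
rewrite !add0r normrN normrM [`|q ^+ d|]ger0_norm ?exprn_ge0 ?(ltW q0) //.
rewrite exprS mulrA ler_pM2r ?exprn_gt0 // => hC.
move: qd; rewrite ltr_pdivlMr // mulrDr mulr1 => qd.
have : C * q <= q * `|C| by rewrite mulrC ler_wpM2l ?ler_norm // ltW.
by lra.
Qed.

(** [eisenstein] is a [lim], which carries information only where the series converges; the growth
    bound ensures this for small [q], where the limit is real. *)
Lemma eisenstein_asymp (R : realType) k (E : fps int) (K : R) r :
    (forall n, eisenstein_coef k n = (E n)%:~R) ->
    (forall n, `|(E n)%:~R : R| <= K * (2 ^ r)%:R ^+ n) ->
  exists phi e, [/\ 0 < e, asymp phi (map_fps (intr : {rmorphism int -> R}) E) &
    forall q, 0 < q < e -> eisenstein k (tau_of q) = (phi q)%:C].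
Proof.
move=> hE bE.
pose u q : nat -> R := series (fun n => (E n)%:~R * q ^+ n).
have e0 : 0 < (2 ^ r.+1)%:R^-1 :> R by rewrite invr_gt0 ltr0n expn_gt0.
have hu q : 0 < q < (2 ^ r.+1)%:R^-1 -> u q @ \oo --> lim (u q @ \oo).
  by move=> hq; exact: (@qseries_cvg R (fun n => (E n)%:~R) K r bE q hq).
exists (fun q => lim (u q @ \oo)), (2 ^ r.+1)%:R^-1; split=> //.
  exact: (asymp_series e0).
move=> q hq; rewrite /eisenstein.
have -> : qseries (fun n => ratr (eisenstein_coef k n)) (tau_of q) = (fun n => (u q n)%:C).
  apply/funext => n; rewrite /qseries /u /series /= rmorph_sum; apply: eq_bigr => i _.
  have /andP[q0 _] := hq.
  by rewrite nome_tau_of // hE ratr_int rmorphM rmorphXn rmorph_int.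
apply: cvg_lim; first exact: norm_hausdorff.
exact/real_complex_cvg/hu.
Qed.

Lemma eisenstein_bound (R : realType) (E : fps int) k r :
    (forall n, `|E n| <= (n == 0)%:R + k%:R * `|sigma r n|) ->
  forall n, `|(E n)%:~R : R| <= k.+1%:R * (2 ^ r.+1)%:R ^+ n.
Proof.
move=> h n.
have p1 : 1 <= (2 ^ r.+1)%:R ^+ n :> R.
  by rewrite exprn_ege1 // ler1n expn_gt0.
apply: (@le_trans _ _ ((n == 0)%:R + k%:R * `|(sigma r n)%:~R|)).
  have := h n; rewrite -(ler_int R) rmorphD rmorphM !rmorph_nat /=.
  by rewrite -!intr_norm.
rewrite -[k.+1]add1n natrD mulrDl mul1r; apply: lerD.
  by apply: le_trans p1; case: eqP.
by rewrite ler_wpM2l // sigma_bound.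
Qed.

Theorem theorem1p7 (R : realType) (p k n a b : nat) (f : R[i] -> R[i])
    (P : {poly rat})
    (p_prime : prime p) (p_ge7 : (7 <= p)%N) (p_mod4 : (p %% 4 = 3)%N)
    (k_def : k = (p.+1 %/ 2)%N) (k_decomp : weight_decomposition k n a b)
    (f_def : is_Ck k n (fun m => (theta_coef m)%:R) f)
    (P_def : is_Pf n a b f P) :
  exists2 r : {poly 'F_p}, reduces_mod P r & splits r.
Proof.
have [ek a_lt3 b_lt2] := k_decomp.
have [m em] : exists m, (4 * m = p.+1)%N by exists (p.+1 %/ 4)%N; lia.
have dec : (2 * m = 12 * n + 4 * a + 6 * b)%N by lia.
have [Dl [disc Dl0 Dl1]] := discriminant_fps.
have [sP hP] := P_def.
(* Everything after this identity is algebraic; what remains analytic is to read it off the values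
   of [f] on the imaginary axis. *)
suff hcoef j : (j <= n)%N -> (\sum_(i < n.+1) fpsC P`_i *
    map_fps (intr : {rmorphism int -> rat}) (mf_basis Dl n a b i)) j = (theta j)%:~R.
  have [Q [PQ hQ]] := @mf_basis_integral Dl n a b Dl0 Dl1 P theta sP hcoef.
  exists (map_poly intr Q); first by exists Q.
  apply: (splits_mod_p p_prime p_ge7 p_mod4 em dec a_lt3 b_lt2 disc _ hQ).
  by rewrite -(size_map_inj_poly (intr_inj : injective (intr : int -> rat))) // -PQ.
have [_ [c fc cth]] := f_def.
pose io : {rmorphism int -> R} := intr.
have bE4 : forall j, `|(E4 j)%:~R : R| <= 241%:R * (2 ^ 4)%:R ^+ j.
  apply: eisenstein_bound => l; rewrite /E4 fpsD fpsMnatl fps1.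
  by rewrite (le_trans (ler_normD _ _)) // normrM !normr_nat.
have bE6 : forall j, `|(E6 j)%:~R : R| <= 505%:R * (2 ^ 6)%:R ^+ j.
  apply: eisenstein_bound => l; rewrite /E6 fpsB fpsMnatl fps1.
  by rewrite (le_trans (ler_normB _ _)) // normrM !normr_nat.
have [phi4 [e4 [e4_gt0 as4 h4]]] := eisenstein_asymp eisenstein_coef4 bE4.
have [phi6 [e6 [e6_gt0 as6 h6]]] := eisenstein_asymp eisenstein_coef6 bE6.
have e1728 : 1728%:R = 12 ^+ 3 :> R[i] by rewrite -natrX; congr (_%:R).
pose phiD q := (12 ^+ 3)^-1 * (phi4 q ^+ 3 + (-1) * phi6 q ^+ 2).
have asD : asymp phiD (map_fps io Dl).
  have -> : map_fps io Dl = fpsC (12 ^+ 3)^-1 *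
      (map_fps io E4 ^+ 3 + fpsC (-1) * map_fps io E6 ^+ 2).
    have redn l : map_fps io l%:R = l%:R by exact: rmorph_nat.
    have -> : map_fps io E4 ^+ 3 + fpsC (-1) * map_fps io E6 ^+ 2 = 12 ^+ 3 * map_fps io Dl.
      rewrite rmorphN1 mulN1r.
      have := congr1 (map_fps io) disc; rewrite [LHS]rmorphM [in LHS]rmorphXn [RHS]rmorphB.
      by rewrite !rmorphXn -(redn 12) => ->.
    rewrite mulrA.
    have -> : fpsC (12 ^+ 3)^-1 * 12 ^+ 3 = 1 :> fps R.
      have -> : 12 ^+ 3 = fpsC (12 ^+ 3) :> fps R by rewrite rmorphXn rmorph_nat.
      rewrite -rmorphM.
      by rewrite mulVf ?rmorph1 // expf_neq0 // pnatr_eq0.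
    by rewrite mul1r.
  apply: asympM; first exact: asymp_cst.
  apply: asympD; first exact: asympX.
  apply: asympM; [exact: asymp_cst | exact: asympX].
have [e40 e60] : E4 0%N = 1 /\ E6 0%N = 1 by case: eisenstein_fps0.
have DlX : map_fps io Dl = @fpsX R * (fun i => (Dl i.+1)%:~R).
  by apply: fps_shift; rewrite /map_fps Dl0.
have [eD eD_gt0 hD] : exists2 e : R, 0 < e & forall q, 0 < q < e -> phiD q != 0.
  apply: (asymp_neq0 (d := 1) asD); last by rewrite /map_fps Dl1 oner_neq0.
  by case=> // _; rewrite /map_fps Dl0.
pose phi0 q := phiD q ^+ n * (phi4 q ^+ a * phi6 q ^+ b).
have as0 : asymp phi0 (map_fps io Dl ^+ n * (map_fps io E4 ^+ a * map_fps io E6 ^+ b)).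
  by apply: asympM; [exact: asympX | apply: asympM; exact: asympX].
have [e0 e0_gt0 h0] : exists2 e : R, 0 < e & forall q, 0 < q < e -> phi0 q != 0.
  apply: (asymp_neq0 (d := n) as0).
    by move=> l lt_ln; rewrite DlX exprMn -mulrA fpsXnM lt_ln.
  rewrite DlX exprMn -mulrA fpsXnM ltnn subnn !fpsM0 !fpsX0 Dl1 /map_fps e40 e60.
  by rewrite !expr1n !mulr1 oner_neq0.
(* [P (j)] times the denominator, after [j^i Delta^n = E4^(3 i) Delta^(n - i)] has removed the
   division by [Delta], which tends to [0]. *)
pose psi q := \sum_(i < n.+1)
  ratr P`_i * (phi4 q ^+ (3 * i + a) * phi6 q ^+ b * phiD q ^+ (n - i)).
have as_psi : asymp psi (\sum_(i < n.+1) fpsC (ratr P`_i) * map_fps io (mf_basis Dl n a b i)).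
  apply: asymp_sum => i; apply: asympM; first exact: asymp_cst.
  rewrite /mf_basis !rmorphM !rmorphXn.
  by apply: asympM; [apply: asympM | ]; exact: asympX.
(* The coefficients [c] are a priori complex, hence the real parts. *)
have as_f : asymp (fun q => complex.Re (f (tau_of q))) (fun j => complex.Re (c j)).
  apply: (asymp_series ltr01) => q hq; have /andP[q0 _] := hq.
  have -> : series (fun l => complex.Re (c l) * q ^+ l) =
      (fun N => complex.Re (qseries c (tau_of q) N)).
    apply/funext => N; rewrite /qseries /series /= raddf_sum; apply: eq_bigr => i _.
    by rewrite nome_tau_of // -rmorphXn /=; case: (c i) => x y /=; rewrite mulr0 subr0.
  exact: Re_cvg (fc _ (upper_tau_of hq)).
pose e := Num.min (Num.min (Num.min e4 e6) (Num.min eD e0)) 1.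
have e_gt0 : 0 < e by rewrite !lt_min e4_gt0 e6_gt0 eD_gt0 e0_gt0 ltr01.
have as_f2 : asymp (fun q => complex.Re (f (tau_of q)))
    (\sum_(i < n.+1) fpsC (ratr P`_i) * map_fps io (mf_basis Dl n a b i)).
  apply: (asymp_ext e_gt0 _ as_psi) => q /andP[q0].
  rewrite !lt_min => /andP[/andP[/andP[q4 q6] /andP[qD q0']] q1].
  have E4q := h4 q; have E6q := h6 q; rewrite q0 q4 in E4q; rewrite q0 q6 in E6q.
  have {}E4q := E4q isT; have {}E6q := E6q isT.
  have Dq : Delta (tau_of q) = (phiD q)%:C.
    rewrite /Delta e1728 E4q E6q /phiD rmorphM fmorphV rmorphXn rmorph_nat /= mulrC; congr (_ * _).
    by rewrite mulN1r rmorphB !rmorphXn.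
  have Dn : phiD q != 0 by apply: hD; rewrite q0.
  have D0 : phi0 q != 0 by apply: h0; rewrite q0.
  have D0C : (phi0 q)%:C = Delta (tau_of q) ^+ n * eisenstein 4 (tau_of q) ^+ a *
      eisenstein 6 (tau_of q) ^+ b.
    rewrite E4q E6q Dq /phi0; move: (phiD q) (phi4 q) (phi6 q) => A B C.
    by rewrite mulrA !rmorphM !rmorphXn.
  have q01 : 0 < q < 1 by rewrite q0.
  have := hP _ (upper_tau_of q01); rewrite /= -D0C.
  have phi0C : (phi0 q)%:C != 0 :> R[i] by rewrite fmorph_eq0.
  move=> /(_ phi0C) ef.
  suff -> : f (tau_of q) = (psi q)%:C by [].
  rewrite -[LHS](divfK phi0C) ef horner_coef /psi rmorph_sum mulr_suml.
  rewrite size_map_poly (big_ord_widen n.+1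
    (fun i => (map_poly ratr P)`_i * jinv (tau_of q) ^+ i * (phi0 q)%:C)) //.
  rewrite big_mkcond; apply: eq_bigr => i _.
  have le_in : (i <= n)%N by rewrite -ltnS.
  have -> : (if (i < size P)%N then (map_poly ratr P)`_i * jinv (tau_of q) ^+ i * (phi0 q)%:C
      else 0) = ratr P`_i * jinv (tau_of q) ^+ i * (phi0 q)%:C.
    by rewrite coef_map; case: ltnP => // h; rewrite nth_default // rmorph0 !mul0r.
  rewrite /jinv E4q Dq -[ratr _](fmorph_rat (real_complex R)) -!rmorphXn -fmorph_div.
  rewrite -!rmorphXn -!rmorphM /=; congr _%:C; rewrite -mulrA; congr (_ * _).
  have Dni : phiD q ^+ n = phiD q ^+ i * phiD q ^+ (n - i) by rewrite -exprD subnKC.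
  rewrite /phi0 Dni expr_div_n exprD exprM.
  have Di0 : phiD q ^+ i != 0 by rewrite expf_neq0.
  move: (phiD q ^+ i) (phiD q ^+ (n - i)) ((phi4 q ^+ 3) ^+ i) (phi4 q ^+ a) (phi6 q ^+ b) Di0.
  by move=> A B C D E A0; field.
(* Up to order [n] the coefficients [c] are those of [theta], so taking real parts loses nothing;
   injectivity of [ratr] then returns the identity to the rationals. *)
have eqc := asymp_unique as_f as_f2.
move=> le_jn; apply: (fmorph_inj (ratr : {rmorphism rat -> R})).
have := congr1 (fun g : fps R => g j) eqc.
rewrite /= cth // => hj.
have -> : ratr (theta j)%:~R = complex.Re ((theta_coef j)%:R : R[i]).
  by rewrite -(rmorph_nat (real_complex R)) /= ratr_int /theta -pmulrn.
rewrite hj !fps_sum rmorph_sum; apply: eq_bigr => i _.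
by rewrite !fpsCM rmorphM /map_fps /= ratr_int.
Qed.
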